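(* For $\alpha>0$ let $\bar u_\alpha$ be the unique solution of $(\mathbb P_\alpha)$, and let $\bar y_\alpha=T\bar u_\alpha$, $\bar y_0=T\bar u_0$ for a solution $\bar u_0$ of $(\mathbb P_0)$. The following statements hold, where $C>0$ denotes constants independent of $\alpha>0$. In each of items 2, 3 and 4, the solution $\bar u_0$ for which the assumption is made is in fact the minimal norm solution $\hat u_0$ of $(\mathbb P_0)$. 1. $\|\bar y_\alpha-\bar y_0\|_H=o(\sqrt\alpha)$ as $\alpha\to0$. 2. Let a solution $\bar u_0$ of $(\mathbb P_0)$ satisfy the source condition with a set $A$ with $\operatorname{meas}(A)=0$. Then for all $\alpha>0$ $$\|\bar u_\alpha-\bar u_0\|_U\le C\sqrt\alpha\quad\text{and}\quad \|\bar y_\alpha-\bar y_0\|_H\le C\alpha .$$ 3. Let a solution $\bar u_0$ of $(\mathbb P_0)$ satisfy the $\bar p_0$-measure condition with a set $A$ with $\operatorname{meas}(A^c)=0$ and exponent $\kappa$. Then $\bar u_0$ is the unique solution of $(\mathbb P_0)$, and for all $\alpha>0$ $$\|\bar u_\alpha-\bar u_0\|_{L^1(\Omega_U)}\le C\alpha^{\kappa},\qquad \|\bar u_\alpha-\bar u_0\|_U\le C\alpha^{\kappa/2},\qquad \|\bar y_\alpha-\bar y_0\|_H\le C\alpha^{(\kappa+1)/2}.$$ If furthermore $\kappa>1$ and $$T^*:\operatorname{range}(T)\to L^\infty(\Omega_U)\ \text{ exists and is continuous}\qquad(\ast)$$ (i.e. $T^*v\in L^\infty(\Omega_U)$ and $\|T^*v\|_{L^\infty(\Omega_U)}\le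 c\,\|v\|_H$ for all $v\in\operatorname{range}(T)\subset H$, with some constant $c>0$), then the last estimate improves to $\|\bar y_\alpha-\bar y_0\|_H\le C\alpha^{\kappa}$. 4. Let a solution $\bar u_0$ of $(\mathbb P_0)$ satisfy both the source condition and the $\bar p_0$-measure condition with the same set $A$, where $\operatorname{meas}(A)\cdot\operatorname{meas}(A^c)>0$, and with exponent $\kappa$. Let in addition $\alpha<1$. Then $$\|\bar u_\alpha-\bar u_0\|_{L^1(A)}\le C\alpha^{\min(\kappa,\,2/(1+1/\kappa))},\qquad \|\bar u_\alpha-\bar u_0\|_U\le C\alpha^{\min(\kappa,1)/2},\qquad \|\bar y_\alpha-\bar y_0\|_H\le C\alpha^{\min((\kappa+1)/2,\,1)} .$$ If furthermore $\kappa>1$ and $(\ast)$ hold, then $\|\bar u_\alpha-\bar u_0\|_{L^1(A)}\le C\alpha^{\kappa}$.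
   Context: Setting. $\Omega_U\subset\mathbb R^n$, $n\ge1$, is a bounded measurable domain, $U:=L^2(\Omega_U)$ (real-valued, scalar product $(\cdot,\cdot)_U$), $H$ is an arbitrary (real) Hilbert space, $z\in H$ is fixed, and $T:U\to H$ is linear and continuous, written as $T=SB$ with continuous linear operators $B:U\to R$, $S:R\to H$ for some function space $R$ (always possible, e.g. $B=\mathrm{Id}$, $S=T$). Adjoints are denoted by $^*$, and $U$, $H$ are identified with their duals. Bounds $a,b\in L^\infty(\Omega_U)$ with $a\le b$ are given and $U_{\rm ad}:=\{u\in U: a(x)\le u(x)\le b(x)\text{ for almost all }x\in\Omega_U\}$. $P_{U_{\rm ad}}:U\to U_{\rm ad}$ is the orthogonal projection. For $\alpha\ge0$, problem $(\mathbb P_\alpha)$ is $\min_{u\in U_{\rm ad}}\ \frac12\|Tu-z\|_H^2+\frac\alpha2\|u\|_U^2$. It has at least one solution $\bar u_\alpha$, which is unique if $\alpha>0$. Put $\bar y_\alpha:=T\bar u_\alpha$ and $\bar p_\alpha:=S^*(\bar y_\alpha-z)$, so that $B^*\bar p_\alpha=T^*(T\bar u_\alpha-z)\in U$; $\bar y_\alpha$ and $\bar p_\alpha$ are unique for every $\alpha\ge0$, even if $\bar u_0$ is not. $\hat u_0$ denotes the (unique) solution of $(\mathbb P_0)$ of minimal $U$-norm. Let $\bar u_0$ be a solution of $(\mathbb P_0)$, $A\subset\Omega_U$ a (measurable) set and $A^c:=\Omega_U\setminus A$. Source condition (with set $A$): $\{x\in\Omega_U:B^*\bar p_0(x)=0\}\subset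 A^c$ and there is $w\in H$ with $T^*w\in L^\infty(\Omega_U)$ and $\chi_{A^c}\bar u_0=\chi_{A^c}P_{U_{\rm ad}}(T^*w)$. $\bar p_0$-measure condition (with set $A$ and exponent $\kappa>0$): $\{x\in\Omega_U:B^*\bar p_0(x)=0\}\subset A^c$ and there is a constant $C\ge0$ such that $\operatorname{meas}(\{x\in A:0\le|B^*\bar p_0(x)|\le\epsilon\})\le C\epsilon^\kappa$ for all $\epsilon>0$, with the convention that $\kappa:=\infty$ if the left-hand side is zero for some $\epsilon>0$. If $\kappa=\infty$, then $1/\kappa=0$, and an estimate whose exponent of $\alpha$ is infinite is read as holding for every finite exponent (with constant depending on that exponent). *)

(* Defs.v *)
From HB Require Import structures.
From mathcomp Require Import all_boot all_order all_algebra.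
From mathcomp Require Import all_classical all_reals all_analysis.

Set Implicit Arguments.
Unset Strict Implicit.
Unset Printing Implicit Defensive.
Import Order.TTheory GRing.Theory Num.Theory.
Import numFieldNormedType.Exports.

Local Open Scope classical_set_scope.
Local Open Scope ring_scope.

(* The ambient space is R^(n+1), so that n : nat covers all dimensions >= 1. *)
Section lebesgue_measure_Rn.
Context (R : realType) (n : nat).
Local Notation E := 'rV[R]_n.+1.
Local Open Scope ereal_scope.

Definition box (c : E * E) : set E :=
  [set x | forall i, (c.1 0 i < x 0 i <= c.2 0 i)%R].

Definition box_volume (c : E * E) : \bar R :=
  (\prod_i Num.max 0 (c.2 0 i - c.1 0 i))%R%:E.

Definition lebesgue_outer_Rn (A : set E) : \bar R :=
  ereal_inf [set \sum_(k <oo) box_volume (F k) |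
             F in [set F : nat -> E * E | A `<=` \bigcup_k box (F k)]].

Let box_volume_ge0 c : 0 <= box_volume c.
Proof.
rewrite lee_fin; apply: prodr_ge0 => i _.
by rewrite le_max lexx.
Qed.

Let box00 : box (0%R, 0%R) = set0.
Proof.
apply/seteqP; split=> // x /(_ ord0) /=.
by move=> /andP[/lt_le_trans h /h]; rewrite ltxx.
Qed.

Let box_volume00 : box_volume (0%R, 0%R) = 0.
Proof. by rewrite /box_volume big_ord_recl /= subrr maxxx mul0r. Qed.

Let lebesgue_outer_Rn_ge0 A : 0 <= lebesgue_outer_Rn A.
Proof. by apply: le_ereal_inf_tmp => _ [F _ <-]; exact: nneseries_ge0. Qed.

Let lebesgue_outer_Rn0 : lebesgue_outer_Rn set0 = 0.
Proof.
apply/eqP; rewrite eq_le lebesgue_outer_Rn_ge0 andbT.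
apply: ereal_inf_lbound; exists (fun=> (0%R, 0%R)) => //.
by apply: eseries0 => k _ _; exact: box_volume00.
Qed.

Let le_lebesgue_outer_Rn :
  {homo lebesgue_outer_Rn : A B / A `<=` B >-> A <= B}.
Proof.
move=> A B AB; apply/ereal_inf_le_tmp => x [F BF <-{x}].
by exists F => //; exact: subset_trans AB BF.
Qed.

Let lebesgue_outer_Rn_sigma_subadditive : sigma_subadditive lebesgue_outer_Rn.
Proof.
move=> A; have [[i ioo]|] := pselect (exists i, lebesgue_outer_Rn (A i) = +oo).
  by rewrite (eseries_pinfty _ _ ioo) ?leey// => k _; rewrite -ltNye
    (lt_le_trans _ (lebesgue_outer_Rn_ge0 _)).
rewrite -forallNE => Aoo; apply/lee_addgt0Pr => e e0.
rewrite (le_trans _ (epsilon_trick _ _ (ltW e0)))//.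
pose P k (F : nat -> E * E) := A k `<=` \bigcup_j box (F j) /\
  \sum_(j <oo) box_volume (F j)
    <= lebesgue_outer_Rn (A k) + (e / (2 ^ k.+1)%:R)%:E.
have [G PG] : {G : nat -> nat -> E * E & forall k, P k (G k)}.
  apply: (@choice _ _ P) => k; rewrite /P.
  have fA : lebesgue_outer_Rn (A k) \is a fin_num.
    by rewrite ge0_fin_numE// ltey; apply/eqP; exact: Aoo.
  have ek : (0 < e / (2 ^ k.+1)%:R)%R by rewrite divr_gt0// ltr0n expn_gt0.
  have [_ [F AF <-] Fe] := lb_ereal_inf_adherent ek fA.
  by exists F; split => //; exact: ltW.
have /card_esym/ppcard_eqP[f] := card_nat2.
pose vol (c : nat * nat) := box_volume (G c.1 c.2).
apply: (@le_trans _ _ (\sum_(k <oo) vol (f k))).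
  apply: ereal_inf_lbound; exists (fun k => G (f k).1 (f k).2) => //.
  move=> t [i _ /(PG i).1[j _ Gij]]; exists (f^-1%FUN (i, j)) => //=.
  by rewrite invK ?inE.
rewrite (_ : \sum_(k <oo) vol (f k) = \esum_(c in setT) vol c); last first.
  rewrite nneseries_esumT; last by move=> *; exact: box_volume_ge0.
  by rewrite [RHS](reindex_esum setT setT f)// => c; exact: box_volume_ge0.
rewrite (_ : esum _ _ = \sum_(i <oo) \sum_(j <oo) vol (i, j)); last first.
  rewrite nneseries_esumT; last first.
    by move=> k; apply: nneseries_ge0 => j _ _; exact: box_volume_ge0.
  under [RHS]eq_esum => k _.
    rewrite nneseries_esumT; last by move=> j; exact: box_volume_ge0.
    over.
  rewrite (@esum_esum R _ _ setT (fun=> setT) (fun i j => vol (i, j))); last first.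
    by move=> *; exact: box_volume_ge0.
  rewrite (_ : _ `*`` _ = setT); last by apply/seteqP; split.
  by apply: eq_esum => -[].
apply: lee_nneseries => [k _ _|k _]; last exact: (PG k).2.
by apply: nneseries_ge0 => j _ _; exact: box_volume_ge0.
Qed.

HB.instance Definition _ := isOuterMeasure.Build R E lebesgue_outer_Rn
  lebesgue_outer_Rn0 lebesgue_outer_Rn_ge0 le_lebesgue_outer_Rn
  lebesgue_outer_Rn_sigma_subadditive.

(* Lebesgue measurable (i.e. Caratheodory measurable) subsets of R^(n+1) and
   the complete Lebesgue measure on them. *)
Definition Rn : measurableType _ := caratheodory_type lebesgue_outer_Rn.

Definition lebesgue_Rn : {measure set Rn -> \bar R} :=
  (lebesgue_outer_Rn : {outer_measure set E -> \bar R}) : set Rn -> \bar R.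

Definition lebesgue_on (Omega : set Rn) (mOmega : measurable Omega) :
  {measure set Rn -> \bar R} := mrestr lebesgue_Rn mOmega.

End lebesgue_measure_Rn.

(* mu stands for Lebesgue measure restricted to the domain. L^2 consists of
   functions, not classes: equality in L^2 is mu-almost everywhere equality,
   and a linear map on functions that is continuous for the L^2 seminorm is the
   same thing as a continuous linear map on classes. *)
Section control_problem.
Context d (X : measurableType d) (R : realType).
Variable mu : {measure set X -> \bar R}.

Definition L2 := LfunType mu (lee1n 2).

Definition innerU (f g : X -> R) : R := \int[mu]_x (f x * g x).

Definition normU (f : X -> R) : R := fine 'N[mu]_2%:E[EFin \o f].

Definition Linfty (f : X -> R) : Prop := f \in Lfun mu +oo%E.

Definition continuousU (V : normedModType R) (L : L2 -> V) : Prop :=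
  forall u (e : R), 0 < e -> exists2 r : R, 0 < r &
    forall v : L2, normU (v - u) < r -> `|L v - L u| < e.

Definition U_ad (a b : X -> R) : set L2 :=
  [set u : L2 | {ae mu, forall x, a x <= u x <= b x}].

Definition is_projection (K : set L2) (f p : L2) : Prop :=
  K p /\ forall v, K v -> normU (f - p) <= normU (f - v).

Section adjoints.
Context (H : completeNormedModType R) (ip : {dot H for idfun}).
Variable V : normedModType R.

(* H and L^2 are identified with their duals, V is not: the dual of V consists
   of the continuous linear functionals on V. *)
Definition adjointS (S : V -> H) (h : H) : V -> R := fun r => ip (S r) h.

Definition is_adjointB (B : L2 -> V) (Bs : (V -> R) -> L2) : Prop :=
  forall phi : {scalar V}, continuous (phi : V -> R) ->
  forall u : L2, innerU (Bs phi) u = phi (B u).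

Definition is_adjointT (T : L2 -> H) (Ts : H -> L2) : Prop :=
  forall (h : H) (u : L2), innerU (Ts h) u = ip h (T u).

End adjoints.

Section problem.
Context (H : normedModType R).
Variables (a b : X -> R) (T : L2 -> H) (z : H).

Definition cost (alpha : R) (u : L2) : R :=
  2^-1 * `|T u - z| ^+ 2 + alpha / 2 * normU u ^+ 2.

Definition is_solution (alpha : R) (u : L2) : Prop :=
  U_ad a b u /\ forall v, U_ad a b v -> cost alpha u <= cost alpha v.

Definition is_minimal_norm_solution (u : L2) : Prop :=
  is_solution 0 u /\ forall v, is_solution 0 v -> normU u <= normU v.

End problem.

Section conditions.
Variables (Omega A : set X).

(* q stands for B^* pbar_0. As q is only determined up to null sets, the
   inclusion {q = 0} `<=` A^c is understood up to null sets. *)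
Definition zero_set_in_compl (q : X -> R) : Prop :=
  {ae mu, forall x, [set y | Omega y /\ q y = 0] x -> (Omega `\` A) x}.

Definition source_condition (H : Type) (a b : X -> R) (Ts : H -> L2)
    (q : X -> R) (u : L2) : Prop :=
  zero_set_in_compl q /\
  exists w : H, Linfty (Ts w) /\
  exists2 p : L2, is_projection (U_ad a b) (Ts w) p &
    {ae mu, forall x, \1_(Omega `\` A) x * u x = \1_(Omega `\` A) x * p x}.

(* kappa = +oo encodes that the measure vanishes for some epsilon. *)
Definition measure_condition (q : X -> R) (kappa : \bar R) : Prop :=
  let level e := [set x | A x /\ 0 <= `|q x| <= e] in
  zero_set_in_compl q /\
  match kappa with
  | k%:E => 0 < k /\ exists2 C : R, 0 <= C & forall e : R, 0 < e ->
      (mu (level e) <= (C * e `^ k)%:E)%E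
  | +oo%E => exists2 e : R, 0 < e & mu (level e) = 0%E
  | -oo%E => False
  end.

End conditions.

Definition Linfty_adjoint (H : normedModType R) (T : L2 -> H)
    (Ts : H -> L2) : Prop :=
  exists2 c : R, 0 < c & forall v, range T v ->
    Linfty (Ts v) /\ ('N[mu]_+oo[EFin \o Ts v] <= (c * `|v|)%:E)%E.


End control_problem.

(* err alpha <= C * alpha ^ e for all alpha in I, with C independent of alpha;
   for e = +oo this is required for every finite exponent, with C depending on
   the exponent. *)
Definition rate (R : realType) (I : set R) (err : R -> \bar R) (e : \bar R) :
    Prop :=
  match e with
  | r%:E => exists2 C : R, 0 < C &
      forall alpha, I alpha -> (err alpha <= (C * alpha `^ r)%:E)%E
  | +oo%E => forall r : R, 0 < r -> exists2 C : R, 0 < C &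
      forall alpha, I alpha -> (err alpha <= (C * alpha `^ r)%:E)%E
  | -oo%E => False
  end.

(* Main.v *)
Require Import Defs.
From HB Require Import structures.
From mathcomp Require Import all_boot all_order all_algebra.
From mathcomp Require Import all_classical all_reals all_analysis.
From mathcomp Require Import measurable_realfun ess_sup_inf ring lra.

(** Write [q] for [B^* p_0], [d = u_alpha - u0], [y = |T d|], [n = |d|], and [D] for the
    L^1 norm of [d] on [A].  The variational inequality of [u_alpha], tested with [u0], reads
      [y^2 + alpha n^2 + (q, d) <= alpha (u0, - d)].
    Off [A] the source condition lets one replace [u0] by [T^*w] on the right, so that
    [(u0, - d) <= L D + |w| y]; testing optimality with functions patched from two
    admissible ones gives [q d >= 0] almost everywhere, and cutting at the level
    [|q| = e] then yields [(q, d) >= e (D - K e^kappa)] for every [e > 0].  The rates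
    follow by choosing [e] of order [alpha], or of order [alpha^(2/(kappa+1))] for the
    L^1 bound under the mixed condition with [kappa > 1].  Since the measure is finite,
    [kappa = +oo] implies the measure condition for every finite exponent. *)

Set Implicit Arguments.
Unset Strict Implicit.
Unset Printing Implicit Defensive.
Import Order.TTheory GRing.Theory Num.Theory.
Import numFieldNormedType.Exports.

Local Open Scope classical_set_scope.
Local Open Scope ring_scope.

(** The obstacle is the term [alpha L D] on the right, which only the growth of [(q, d)] absorbs:
    this forces [e] to be at least a multiple of [alpha], and the price is [K e^kappa]. The term
    [alpha |w| y] is absorbed in [y^2] and leaves [alpha^2 |w|^2], a contribution of order
    [alpha^2 / e] to [D]; that is why a larger level pays off once [kappa > 1]. If [A] has full
    measure, [w = 0] removes this contribution. For a second solution of the unregularized problem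
    [y] and [(q, d)] vanish, growth forces [D = 0], and the remaining inequality [(u0, - d) <= 0]
    gives minimality of the norm. Under [Linfty_adjoint] the gain comes from
    [y^2 = (T^*T d, d) <= c y D] if [A] has full measure, and otherwise from using optimality
    pointwise on [A] instead of in integrated form. Finite exponents do not settle [kappa = +oo]
    under the mixed condition: they reach only [2 k / (k + 1) < 2], so the exponent 2 needs its own
    argument at a fixed level. *)

Section integration.
Context d (X : measurableType d) (R : realType).
Variable mu : {measure set X -> \bar R}.
Implicit Types f g h : X -> R.

Local Notation intble f := (mu.-integrable setT (EFin \o f)).

Lemma ae_ge0_Rintegral f : measurable_fun setT f ->
  {ae mu, forall x, 0 <= f x} -> 0 <= \int[mu]_x f x.
Proof.
move=> mf f0; rewrite /Rintegral (@ae_eq_integral _ _ _ mu _ (fun x => `|f x|%:E))//.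
- by apply: fine_ge0; apply: integral_ge0 => x _; rewrite lee_fin.
- exact/measurable_EFinP.
- by apply/measurable_EFinP; exact: measurableT_comp.
- by apply: filterS f0 => x f0 _ /=; rewrite ger0_norm.
Qed.

Lemma ae_le_Rintegral f g : intble f -> intble g ->
  {ae mu, forall x, f x <= g x} -> \int[mu]_x f x <= \int[mu]_x g x.
Proof.
move=> fi gi fg; rewrite -subr_ge0 -RintegralB//; apply: ae_ge0_Rintegral.
  by apply: measurable_funB; apply/measurable_EFinP; apply: (measurable_int mu).
by apply: filterS fg => x; rewrite subr_ge0.
Qed.

Lemma integrable_cmul f (c : R) : intble f -> intble (fun x => c * f x).
Proof. by move=> fi; exact: (integrableZl measurableT c fi). Qed.

Lemma integrable_subr f g : intble f -> intble g -> intble (fun x => f x - g x).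
Proof. by move=> fi gi; exact: (integrableB measurableT fi gi). Qed.

Lemma integrable_addr f g : intble f -> intble g -> intble (fun x => f x + g x).
Proof. by move=> fi gi; exact: (integrableD measurableT fi gi). Qed.

Lemma integrable_bdM f h (M : R) : measurable_fun setT h ->
  (forall x, `|h x| <= M) -> intble f -> intble (fun x => h x * f x).
Proof.
move=> mh hM fi.
have mf : measurable_fun setT f by apply/measurable_EFinP; exact: (measurable_int mu).
apply: (@le_integrable _ _ _ mu _ measurableT _ (EFin \o (fun x => M * f x))).
- by apply/measurable_EFinP; exact: measurable_funM.
- move=> x _ /=; rewrite lee_fin !normrM ler_wpM2r//.
  by rewrite (le_trans (hM x))// ler_norm.
- exact: integrable_cmul.
Qed.

Lemma integrable_indicM f (A : set X) : measurable A -> intble f ->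
  intble (fun x => \1_A x * f x).
Proof.
move=> mA; apply: (@integrable_bdM _ _ 1); first exact: measurable_indic.
by move=> x; rewrite indicE; case: (x \in A); rewrite ?normr1 ?normr0.
Qed.

Lemma integrable_norm_fun f : intble f -> intble (fun x => `|f x|).
Proof. exact: integrable_norm. Qed.

Lemma Rintegral_ge0_eq0 f : intble f -> {ae mu, forall x, 0 <= f x} ->
  \int[mu]_x f x = 0 -> {ae mu, forall x, f x = 0}.
Proof.
move=> fi f0 If0.
have mf := measurable_int _ fi.
have /(ae_eq_integral_abs mu measurableT mf) : (\int[mu]_x `|(EFin \o f) x| = 0)%E.
  rewrite (@ae_eq_integral _ _ _ mu _ (EFin \o f))//.
  - by rewrite -[LHS]fineK ?integrable_fin_num//; congr EFin.
  - exact: measurableT_comp.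
  - by apply: filterS f0 => x f0 _ /=; rewrite ger0_norm.
by apply: filterS => x /(_ I) [].
Qed.

Lemma Rintegral_indic_null f (A : set X) : measurable A -> mu A = 0%E ->
  measurable_fun setT f -> \int[mu]_x (\1_A x * f x) = 0.
Proof.
move=> mA A0 mf; rewrite /Rintegral (@ae_eq_integral _ _ _ mu _ (cst 0%E))//.
- by rewrite integral0.
- by apply/measurable_EFinP; apply: measurable_funM => //; exact: measurable_indic.
- exists A; split => // x /= /not_implyP [_] xA; apply: contrapT => nA; apply: xA.
  by rewrite indicE memNset// mul0r.
Qed.

Lemma measurable_sublevel (A : set X) g (e : R) : measurable A ->
  measurable_fun setT g -> measurable [set x | A x /\ 0 <= `|g x| <= e].
Proof.
move=> mA mg; set N := [set x | _].
have -> : N = A `&` ((fun x => `|g x|) @^-1` `]-oo, e]).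
  apply/seteqP; split=> x; rewrite /N /= in_itv /=.
    by move=> [? /andP[_ ?]].
  by move=> [Ax gx]; split=> //; rewrite normr_ge0.
apply: measurableI => //; rewrite -[_ @^-1` _]setTI.
by apply: measurableT_comp => //; exact: measurableT_comp.
Qed.

(* Off the level set [`|g| <= e] one has [e * `|f| <= `|g| * `|f|]; on it [`|f|]
   is bounded by [M]. *)
Lemma growth_estimate (A : set X) f g (M e m : R) :
  measurable A -> (mu A < +oo)%E -> intble f -> measurable_fun setT g ->
  intble (fun x => `|g x| * `|f x|) ->
  0 < e -> 0 <= M -> {ae mu, forall x, `|f x| <= M} ->
  (mu [set x | A x /\ (0 <= `|g x| <= e)%R] <= m%:E)%E ->
  e * (\int[mu]_x (\1_A x * `|f x|) - M * m) <=
  \int[mu]_x (\1_A x * (`|g x| * `|f x|)).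
Proof.
move=> mA Aoo fi mg gfi e0 M0 fM; set N := [set x | _].
have mN : measurable N by exact: measurable_sublevel.
move=> Nm.
have iN : intble (fun x => M * \1_N x).
  apply: integrable_cmul => //; apply/integrableP; split.
    by apply/measurable_EFinP; exact: measurable_indic.
  rewrite (eq_integral (fun x => (\1_N x)%:E)); last first.
    by move=> t _; rewrite gee0_abs// lee_fin.
  by rewrite integral_indic// setIT (le_lt_trans Nm)// ltry.
have iA : intble (fun x => \1_A x * `|f x|).
  by apply: integrable_indicM => //; exact: integrable_norm_fun.
apply: (@le_trans _ _ (\int[mu]_x (e * (\1_A x * `|f x| - M * \1_N x)))).
  rewrite RintegralZl//; last exact: integrable_subr.
  rewrite ler_pM2l// RintegralB// lerD2l lerN2 RintegralZl//; last first.
    apply/integrableP; split.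
      by apply/measurable_EFinP; exact: measurable_indic.
    rewrite (eq_integral (fun x => (\1_N x)%:E)); last first.
      by move=> t _; rewrite gee0_abs// lee_fin.
    by rewrite integral_indic// setIT (le_lt_trans Nm)// ltry.
  rewrite ler_wpM2l// /Rintegral integral_indic// setIT.
  by rewrite -lee_fin fineK// ge0_fin_numE// (le_lt_trans Nm)// ltry.
apply: ae_le_Rintegral.
- by apply: integrable_cmul => //; exact: integrable_subr.
- exact: integrable_indicM.
apply: filterS fM => x fM.
rewrite !indicE; have [xA|xA] := boolP (x \in A); last first.
  rewrite !mul0r memNset ?mulr0 ?subrr ?mulr0// => -[/mem_set].
  by rewrite (negPf xA).
rewrite !mul1r; have [ge|ge] := leP `|g x| e.
  rewrite mem_set; last by split; [exact: set_mem|rewrite normr_ge0].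
  rewrite mulr1 (@le_trans _ _ 0)// ?mulr_ge0//.
  by rewrite mulr_ge0_le0 ?subr_le0// ltW.
rewrite memNset; last by move=> [_ /andP[_]]; rewrite leNgt ge.
by rewrite mulr0 subr0 ler_wpM2r// ltW.
Qed.

End integration.

(** * The scalar product of L^2 *)

Section L2_inner_product.
Context d (X : measurableType d) (R : realType).
Variable mu : {measure set X -> \bar R}.
Implicit Types u v w : L2 mu.

Lemma L2_mul_integrable u v : mu.-integrable setT (EFin \o (fun x => u x * v x)).
Proof. by apply/Lfun1_integrable; exact: (Lfun2_mul_Lfun1 (LfunP u) (LfunP v)). Qed.

Lemma innerUC u v : innerU mu u v = innerU mu v u.
Proof. by apply: eq_Rintegral => x _; rewrite mulrC. Qed.

Lemma innerUDl u v w : innerU mu (u + v) w = innerU mu u w + innerU mu v w.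
Proof.
rewrite -RintegralD//; [|exact: L2_mul_integrable..].
by apply: eq_Rintegral => x _; rewrite -mulrDl.
Qed.

Lemma innerUZl (c : R) u v : innerU mu (c *: u) v = c * innerU mu u v.
Proof.
rewrite -RintegralZl//; last exact: L2_mul_integrable.
by apply: eq_Rintegral => x _; rewrite mulrA.
Qed.

Lemma innerUDr u v w : innerU mu w (u + v) = innerU mu w u + innerU mu w v.
Proof. by rewrite innerUC innerUDl !(innerUC w). Qed.

Lemma innerUZr (c : R) u v : innerU mu u (c *: v) = c * innerU mu u v.
Proof. by rewrite innerUC innerUZl innerUC. Qed.

Lemma innerUNl u v : innerU mu (- u) v = - innerU mu u v.
Proof. by rewrite -scaleN1r innerUZl mulN1r. Qed.

Lemma innerUNr u v : innerU mu u (- v) = - innerU mu u v.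
Proof. by rewrite innerUC innerUNl innerUC. Qed.

Definition innerUE := (innerUDl, innerUDr, innerUNl, innerUNr, innerUZl, innerUZr).

Lemma innerU_ge0 u : 0 <= innerU mu u u.
Proof. by apply: Rintegral_ge0 => x _; rewrite -expr2 sqr_ge0. Qed.

Lemma normU_ge0 u : 0 <= normU mu u.
Proof. by rewrite fine_ge0// Lnorm_ge0. Qed.

Lemma normU_sqr u : normU mu u ^+ 2 = innerU mu u u.
Proof.
apply: EFin_inj; rewrite -powR_mulrn ?normU_ge0// -poweR_EFin finite_norm_fine.
rewrite powR_Lnorm ?pnatr_eq0// fineK ?integrable_fin_num//; last first.
  exact: L2_mul_integrable.
apply: eq_integral => x _; rewrite /= powR_mulrn// -normrX ger0_norm ?sqr_ge0//.
Qed.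

Lemma ler_normU u v : innerU mu u u <= innerU mu v v -> normU mu u <= normU mu v.
Proof. by rewrite -!normU_sqr ler_pXn2r// nnegrE normU_ge0. Qed.

End L2_inner_product.

(** * Pointwise bounds and pasting of admissible functions *)

Section admissible_set.
Context d (X : measurableType d) (R : realType).
Variable mu : {measure set X -> \bar R}.
Implicit Types u v w g : L2 mu.

Lemma Lnorm_infty_ae_le (f : X -> R) (c : R) :
  ('N[mu]_+oo[EFin \o f] <= c%:E)%E -> {ae mu, forall x, `|f x| <= c}.
Proof.
rewrite unlock /Lnorm; case: ifPn => [_ /ess_supP|].
  by apply: filterS => x /=; rewrite lee_fin.
(* The norm at infinity is defined by cases on the positivity of the total measure; for the zero
   measure every property holds almost everywhere. *)
rewrite lt0e measure_ge0 andbT negbK => /eqP mu0 _.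
by exists setT; split.
Qed.

Lemma Linfty_ae_bounded (f : X -> R) : Linfty mu f ->
  exists2 M : R, 0 < M & {ae mu, forall x, `|f x| <= M}.
Proof.
rewrite /Linfty inE => /andP[_]; rewrite inE /= /finite_norm => foo.
have fM := Lnorm_ge0 mu +oo%E (EFin \o f).
(* The [+ 1] keeps the bound strictly positive; it ends up in the constant [L], by which one later
   divides. *)
exists (fine ('N[mu]_+oo[EFin \o f])%E + 1).
  by rewrite ltr_wpDl// fine_ge0.
apply: Lnorm_infty_ae_le.
by rewrite EFinD fineK ?ge0_fin_numE// leeDl.
Qed.

Lemma L2_indicM (N : set X) g : measurable N ->
  exists w, forall x, w x = \1_N x * g x.
Proof.
move=> mN; have mf : measurable_fun setT (fun x => \1_N x * g x).
  by apply: measurable_funM => //; exact: measurable_indic.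
suff fP : (fun x => \1_N x * g x) \in Lfun mu 2%:E.
  by exists (Lfun_Sub (lee1n 2) fP).
rewrite inE; apply/andP; split; rewrite inE//=.
rewrite /finite_norm unlock /Lnorm poweR_lty//.
have /integrableP[_] := L2_mul_integrable g g; apply: le_lt_trans.
apply: ge0_le_integral => //.
- by move=> x _; exact: poweR_ge0.
- apply/measurable_EFinP; apply: (measurableT_comp (measurable_powR _)) => //.
  exact: measurableT_comp.
- by apply: measurableT_comp => //; apply/measurable_EFinP; exact: measurable_funM.
move=> x _; rewrite /= lee_fin powR_mulrn// normrM exprMn -expr2 normrX.
rewrite ler_piMl ?sqr_ge0// indicE; case: (x \in N).
  by rewrite normr1 expr1n.
by rewrite normr0 expr0n/= ler01.
Qed.

Variables a b : X -> R.
Let Uad := U_ad a b : set (L2 mu).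

Lemma U_ad_ae_bounded : Linfty mu a -> Linfty mu b ->
  exists2 M : R, 0 < M & forall u, Uad u -> {ae mu, forall x, `|u x| <= M}.
Proof.
move=> /Linfty_ae_bounded[Ma Ma0 aM] /Linfty_ae_bounded[Mb Mb0 bM].
exists (Ma + Mb); first exact: addr_gt0.
move=> u uad; apply: filterS3 uad aM bM => x /andP[au ub].
rewrite !ler_norml => /andP[aM _] /andP[_ bM].
by apply/andP; split; lra.
Qed.

Lemma U_ad_segment u v (t : R) : Uad u -> Uad v -> 0 <= t <= 1 ->
  Uad (u + t *: (v - u)).
Proof.
move=> uad vad t01; apply: filterS2 uad vad => x uab vab.
rewrite (_ : (u + t *: (v - u)) x = u x + t * (v x - u x))//; nra.
Qed.

(** The bounds are pointwise, so [v] may be pasted into [u] on any measurable set. The difference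
    [w - u] is recorded because it is the direction that enters a variational inequality. *)
Lemma U_ad_patch u v (N : set X) : measurable N -> Uad u -> Uad v ->
  exists2 w, Uad w & forall x, w x - u x = \1_N x * (v x - u x).
Proof.
move=> mN uad vad; have [w wE] := L2_indicM (v - u) mN.
exists (u + w) => [|x]; last first.
  by rewrite -[v x - u x]/((v - u) x) -wE -[(u + w) x]/(u x + w x) addrC addKr.
apply: filterS2 uad vad => x uab vab.
rewrite -[(u + w) x]/(u x + w x) wE -[(v - u) x]/(v x - u x) indicE.
by case: (x \in N); rewrite ?mul1r ?subrKC// mul0r addr0.
Qed.

(** Localization: pasting [v] into [u] exactly where the integrand is negative turns the integrated
    inequality into a bound that forces the negative part to have integral 0. *)
Lemma variational_inequality_ae g u v : Uad u ->
  (forall w, Uad w -> 0 <= innerU mu g (w - u)) -> Uad v ->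
  {ae mu, forall x, 0 <= g x * (v x - u x)}.
Proof.
move=> uad VI vad; set h := fun x => g x * (v x - u x).
have mh : measurable_fun setT h by apply: measurable_funM => //; exact: measurable_funB.
pose N := h @^-1` `]-oo, 0[.
have mN : measurable N by rewrite -[N]setTI; exact: mh.
have [w wad wE] := U_ad_patch mN uad vad.
have hi : mu.-integrable setT (EFin \o h) := L2_mul_integrable g (v - u).
have ni : mu.-integrable setT (EFin \o (fun x => - (\1_N x * h x))).
  by have := integrable_indicM mN hi; move/integrableN.
have n0 x : 0 <= - (\1_N x * h x).
  rewrite oppr_ge0 indicE; have [|_] := boolP (x \in N); last by rewrite mul0r.
  by rewrite inE /N /= in_itv /= mul1r => /ltW.
have : {ae mu, forall x, - (\1_N x * h x) = 0}.
  apply: Rintegral_ge0_eq0 => //; first exact: aeW.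
  apply/eqP; rewrite eq_le Rintegral_ge0// andbT.
  have := VI w wad; rewrite /innerU (_ : (fun x => _) = fun x => \1_N x * h x).
    rewrite -oppr_le0; apply: le_trans.
    under eq_Rintegral do rewrite -mulN1r.
    rewrite RintegralZl//; last exact: integrable_indicM.
    by rewrite mulN1r.
  by apply/funext => x; rewrite -[(w - u) x]/(w x - u x) wE mulrCA.
apply: filterS => x /eqP; rewrite oppr_eq0 indicE.
have [_|] := boolP (x \in N); last first.
  by rewrite notin_setE /N /= in_itv /= => /negP; rewrite -leNgt.
by rewrite mul1r => /eqP; rewrite /h => ->.
Qed.

End admissible_set.

Lemma first_order_ge0 (R : realFieldType) (p r : R) :
  (forall t, 0 < t <= 1 -> 0 <= t * p + t ^+ 2 * r) -> 0 <= p.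
Proof.
move=> h; rewrite leNgt; apply/negP => p0.
have rp : 0 < `|r| - p by rewrite subr_gt0 (lt_le_trans p0).
have t01 : 0 < - p / (`|r| - p) <= 1.
  by rewrite divr_gt0 ?oppr_gt0//= ler_pdivrMr// mul1r lerDr.
(* This [t] solves [p + t |r| = t p], which is negative when [p] is, contradicting the hypothesis
   after division by [t]. *)
set t := - p / (`|r| - p) in t01.
have := h t t01; have /andP[t0 _] := t01.
rewrite expr2 -mulrA -mulrDr pmulr_rge0// leNgt => /negP; apply.
apply: (@le_lt_trans _ _ (p + t * `|r|)); first by rewrite lerD2l ler_wpM2l ?ler_norm// ltW.
have -> : p + t * `|r| = t * p by rewrite /t; field; rewrite gt_eqF.
by rewrite pmulr_rlt0.
Qed.

(** * First-order optimality conditions *)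

Section optimality.
Context d (X : measurableType d) (R : realType).
Variable mu : {measure set X -> \bar R}.
Context (H : completeNormedModType R) (ip : {dot H for idfun}).
Hypothesis ip_norm : forall h : H, ip h h = `|h| ^+ 2.
Implicit Types u v w : L2 mu.

Lemma ipC (x y : H) : ip x y = ip y x.
Proof. by rewrite hermitian_subproof mul1r. Qed.

Lemma ipDl (x y w : H) : ip (x + y) w = ip x w + ip y w.
Proof. by rewrite linearDl. Qed.

Lemma ipZl (c : R) (x y : H) : ip (c *: x) y = c * ip x y.
Proof. by rewrite linearZl_LR. Qed.

Lemma ipNl (x y : H) : ip (- x) y = - ip x y.
Proof. by rewrite -scaleN1r ipZl mulN1r. Qed.

Lemma ipDr (x y w : H) : ip w (x + y) = ip w x + ip w y.
Proof. by rewrite ipC ipDl !(ipC w). Qed.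

Lemma ipZr (c : R) (x y : H) : ip x (c *: y) = c * ip x y.
Proof. by rewrite ipC ipZl ipC. Qed.

Lemma ipNr (x y : H) : ip x (- y) = - ip x y.
Proof. by rewrite ipC ipNl ipC. Qed.

Definition ipE := (ipDl, ipDr, ipNl, ipNr, ipZl, ipZr).

Lemma normD_sqr (x y : H) :
  `|x + y| ^+ 2 = `|x| ^+ 2 + 2 * ip x y + `|y| ^+ 2.
Proof. by rewrite -!ip_norm !ipE (ipC y x); ring. Qed.

Lemma ip_le_norm (x y : H) : ip x y <= `|x| * `|y|.
Proof.
have : `|x + y| ^+ 2 <= (`|x| + `|y|) ^+ 2 by rewrite ler_pXn2r ?nnegrE// ?ler_normD.
by rewrite normD_sqr; lra.
Qed.

Variables (a b : X -> R) (T : {linear L2 mu -> H}) (z : H).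

Lemma solution_variational_inequality (alpha : R) u v :
  is_solution a b T z alpha u -> U_ad a b v ->
  0 <= alpha * innerU mu u (v - u) + ip (T u - z) (T v - T u).
Proof.
(* The direction is made opaque so that expanding the quadratic cost along the segment does not
   split it. *)
move=> [uad umin] vad; have [h hE] : exists h, h = v - u by exists (v - u).
rewrite -(linearB T) -hE.
apply: (@first_order_ge0 _ _
  (2^-1 * `|T h| ^+ 2 + alpha / 2 * innerU mu h h)) => t /andP[t0 t1].
have /umin : U_ad a b (u + t *: h) by rewrite hE; apply: U_ad_segment; rewrite ?(ltW t0).
rewrite /cost !normU_sqr linearD linearZ_LR addrAC (normD_sqr (T u - z)).
rewrite normrZ exprMn ger0_norm ?(ltW t0)// ipZr !innerUE (innerUC h u).
lra.
Qed.

Lemma projection_variational_inequality (f p : L2 mu) v :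
  is_projection (U_ad a b) f p -> U_ad a b v -> 0 <= innerU mu (p - f) (v - p).
Proof.
move=> [pad pmin] vad; have [h hE] : exists h, h = v - p by exists (v - p).
(* The quantity with factor 2 is the slope at [t = 0] of the squared distance from [f] to
   [p + t h]. *)
suff : 0 <= 2 * innerU mu (p - f) h by rewrite pmulr_rge0// hE.
apply: (@first_order_ge0 _ _ (innerU mu h h)) => t /andP[t0 t1].
have /pmin : U_ad a b (p + t *: h) by rewrite hE; apply: U_ad_segment; rewrite ?(ltW t0).
rewrite -(ler_pXn2r (n := 2))// ?nnegrE ?normU_ge0// !normU_sqr !innerUE.
rewrite (innerUC p f) (innerUC h p) (innerUC h f); lra.
Qed.

End optimality.

(** * Energy, growth, source and pointwise estimates *)

Section estimates.
Context d (X : measurableType d) (R : realType).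
Variable mu : {measure set X -> \bar R}.
Hypothesis muoo : (mu setT < +oo)%E.
Implicit Types u v : L2 mu.

(** Real-valued and taken over the whole space, so that a single pointwise inequality compares it
    with a scalar product; [L1onE] and [Lnorm1_L1on] lead back to the extended real quantities. *)
Definition L1on (A : set X) (f : X -> R) : R := \int[mu]_x (\1_A x * `|f x|).

Lemma L2_integrable u : mu.-integrable setT (EFin \o u).
Proof.
apply/Lfun1_integrable; apply: Lfun_subset12; last exact: LfunP.
by rewrite ge0_fin_numE.
Qed.

Lemma L1on_integrable (A : set X) u : measurable A ->
  mu.-integrable setT (EFin \o (fun x => \1_A x * `|u x|)).
Proof.
by move=> mA; apply: integrable_indicM => //; apply/integrable_norm_fun/L2_integrable.
Qed.

Lemma L1on_ge0 (A : set X) (f : X -> R) : 0 <= L1on A f.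
Proof. by apply: Rintegral_ge0 => x _; rewrite mulr_ge0. Qed.

Lemma L1onE (A : set X) u : measurable A ->
  (\int[mu]_(x in A) `|u x|%:E = (L1on A u)%:E)%E.
Proof.
move=> mA; rewrite fineK; last first.
  by apply: integrable_fin_num => //; exact: (L1on_integrable u mA).
rewrite integral_mkcond; apply: eq_integral => x _.
by rewrite patchE indicE; case: ifP; rewrite ?mul1r ?mul0r.
Qed.

Lemma Lnorm1_L1on (A : set X) u : measurable A -> mu (~` A) = 0%E ->
  'N[mu]_1[EFin \o u]%E = (L1on A u)%:E.
Proof.
move=> mA A0; rewrite Lnorm1 -L1onE//.
rewrite -(setvU A) integral_setU_EFin//.
- rewrite [X in (X + _)%E = _](_ : _ = 0%E) ?add0e//.
  rewrite (@integral_abs_eq0 _ _ _ mu _ (EFin \o u))//; first exact: measurableC.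
  by apply/measurable_EFinP; apply: measurable_funTS.
- exact: measurableC.
- by rewrite setvU; exact: measurableT_comp.
- by rewrite disj_set_sym; exact/disj_setPCl.
Qed.

Lemma L1on_null (A : set X) u : measurable A -> mu A = 0%E -> L1on A u = 0.
Proof.
move=> mA A0; apply: Rintegral_indic_null => //.
exact: measurableT_comp.
Qed.

Context (H : completeNormedModType R) (ip : {dot H for idfun}).
Hypothesis ip_norm : forall h : H, ip h h = `|h| ^+ 2.
Variables (a b : X -> R) (T : {linear L2 mu -> H}) (z : H).
Variables (Ts : H -> L2 mu) (u0 q : L2 mu).
Hypothesis Ts_adj : is_adjointT ip T Ts.
Hypothesis u0_sol : is_solution a b T z 0 u0.
Hypothesis qE : forall u, innerU mu q u = ip (T u0 - z) (T u).

Let Uad := U_ad a b : set (L2 mu).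

Lemma energy_estimate (alpha : R) u : is_solution a b T z alpha u ->
  `|T u - T u0| ^+ 2 + alpha * normU mu (u - u0) ^+ 2 + innerU mu q (u - u0)
  <= alpha * innerU mu u0 (u0 - u).
Proof.
move=> usol; have := solution_variational_inequality ip_norm usol u0_sol.1.
rewrite normU_sqr qE (linearB T) -ip_norm !innerUE !(ipE ip).
rewrite (ipC ip (T u0) (T u)) (innerUC u u0); lra.
Qed.

Lemma adjoint_state_innerU_ge0 v : Uad v -> 0 <= innerU mu q (v - u0).
Proof.
move=> vad; have := solution_variational_inequality ip_norm u0_sol vad.
by rewrite mul0r add0r qE (linearB T).
Qed.

Lemma adjoint_state_ae_ge0 v : Uad v -> {ae mu, forall x, 0 <= q x * (v x - u0 x)}.
Proof.
apply: variational_inequality_ae u0_sol.1 _ => w; exact: adjoint_state_innerU_ge0.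
Qed.

(** The energy estimate with [alpha = 0] bounds the sum of two nonnegative terms by 0, so both
    vanish. *)
Lemma unregularized_solution_eq v : is_solution a b T z 0 v ->
  T v = T u0 /\ innerU mu q (v - u0) = 0.
Proof.
move=> vsol; have := energy_estimate vsol; have := adjoint_state_innerU_ge0 vsol.1.
rewrite !mul0r addr0 => q0 le0; have := sqr_ge0 `|T v - T u0|.
split; last lra.
have : `|T v - T u0| ^+ 2 = 0 by lra.
by move=> /eqP; rewrite sqrf_eq0 normr_eq0 subr_eq0 => /eqP.
Qed.

(** The bound [m] on the level set is left free: it receives a power of [e] for a finite exponent,
    and 0 when the level set is null. *)
Lemma growth_condition (A : set X) v (M e m : R) :
  measurable A -> 0 < e -> 0 <= M -> Uad v ->
  {ae mu, forall x, `|(v - u0) x| <= M} ->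
  (mu [set x | A x /\ (0 <= `|q x| <= e)%R] <= m%:E)%E ->
  e * (L1on A (v - u0) - M * m) <= innerU mu q (v - u0).
Proof.
move=> mA e0 M0 vad vM Am.
have qi : mu.-integrable setT (EFin \o (fun x => `|q x| * `|(v - u0) x|)).
  have /integrable_norm_fun := L2_mul_integrable q (v - u0).
  by apply: eq_integrable => // x _; rewrite /= normrM.
apply: (@le_trans _ _ (\int[mu]_x (\1_A x * (`|q x| * `|(v - u0) x|)))).
  apply: growth_estimate => //; last exact: L2_integrable.
  by rewrite (le_lt_trans _ muoo)// le_measure ?inE.
(* As [q (v - u0)] is nonnegative almost everywhere, it equals its absolute value, and discarding
   the part off [A] only lowers the integral. *)
apply: ae_le_Rintegral => //.
- exact: integrable_indicM.
- exact: L2_mul_integrable.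
apply: filterS (adjoint_state_ae_ge0 vad) => x q0.
rewrite -normrM [(v - u0) x]/(v x - u0 x) ger0_norm// indicE.
by case: (x \in A); rewrite ?mul1r// mul0r.
Qed.

(** On [A] the crude bound [M + W] of [u0 - T^*w] is paid for by the L^1 norm; off [A] the last
    hypothesis, the sign condition characterizing a pointwise projection, allows the exchange. What
    remains, [(T^*w, u0 - v)], is moved to [H] by the adjoint. If [A] has full measure the sign
    condition is void. *)
Lemma source_estimate (A : set X) (w : H) (M W : R) v : measurable A ->
  {ae mu, forall x, `|u0 x| <= M} -> {ae mu, forall x, `|Ts w x| <= W} ->
  {ae mu, forall x, ~ A x -> 0 <= (u0 x - Ts w x) * (v x - u0 x)} ->
  innerU mu u0 (u0 - v) <= (M + W) * L1on A (v - u0) + `|w| * `|T v - T u0|.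
Proof.
move=> mA uM wW src.
apply: (@le_trans _ _ ((M + W) * L1on A (v - u0) + innerU mu (Ts w) (u0 - v))).
  rewrite -RintegralZl//; last exact: L1on_integrable.
  rewrite -RintegralD//; last 2 first.
  - by apply: integrable_cmul; exact: L1on_integrable.
  - exact: L2_mul_integrable.
  apply: ae_le_Rintegral.
  - exact: L2_mul_integrable.
  - apply: integrable_addr; last exact: L2_mul_integrable.
    by apply: integrable_cmul; exact: L1on_integrable.
  apply: filterS3 uM wW src => x uM wW src.
  rewrite -[(u0 - v) x]/(u0 x - v x) -[(v - u0) x]/(v x - u0 x) indicE.
  have [xA|xA] := boolP (x \in A).
    rewrite mul1r -lerBlDr -mulrBl (le_trans (ler_norm _))// normrM (distrC (u0 x) (v x)).
    by rewrite ler_wpM2r// (le_trans (ler_normB _ _))// lerD.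
  rewrite mul0r mulr0 add0r.
  have nA : ~ A x by move/mem_set; rewrite (negPf xA).
  by have := src nA; lra.
rewrite lerD2l Ts_adj (linearB T) (le_trans (ip_le_norm ip_norm _ _))//.
by rewrite distrC.
Qed.

(* Pointwise optimality of [u] and [u0] gives
   [|q| |u - u0| <= (alpha |u| + |T^*(T u - T u0)|) |u - u0|] almost everywhere. *)
Lemma bang_bang_estimate (A : set X) (alpha : R) u (M M' e m P : R) :
  measurable A -> 0 < e -> 0 <= M' -> 0 <= alpha -> is_solution a b T z alpha u ->
  {ae mu, forall x, `|u x| <= M} -> {ae mu, forall x, `|(u - u0) x| <= M'} ->
  {ae mu, forall x, `|Ts (T u - T u0) x| <= P} ->
  (mu [set x | A x /\ (0 <= `|q x| <= e)%R] <= m%:E)%E ->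
  e * (L1on A (u - u0) - M' * m) <= (alpha * M + P) * L1on A (u - u0).
Proof.
move=> mA e0 M0 al0 usol uM uM' uP Am.
have qi : mu.-integrable setT (EFin \o (fun x => `|q x| * `|(u - u0) x|)).
  have /integrable_norm_fun := L2_mul_integrable q (u - u0).
  by apply: eq_integrable => // x _; rewrite /= normrM.
apply: (@le_trans _ _ (\int[mu]_x (\1_A x * (`|q x| * `|(u - u0) x|)))).
  apply: growth_estimate => //; last exact: L2_integrable.
  by rewrite (le_lt_trans _ muoo)// le_measure ?inE.
rewrite -RintegralZl//; last exact: L1on_integrable.
apply: ae_le_Rintegral.
- exact: integrable_indicM.
- by apply: integrable_cmul; exact: L1on_integrable.
(* The gradient [alpha u + T^*(T u - z)] is split at [u0], so that [q] appears explicitly and can be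
   isolated by comparing signs. *)
have optu : {ae mu, forall x,
    0 <= (alpha *: u + (q + Ts (T u - T u0))) x * (u0 x - u x)}.
  apply: variational_inequality_ae usol.1 _ u0_sol.1 => w wad.
  have := solution_variational_inequality ip_norm usol wad.
  rewrite innerUDl innerUZl innerUDl qE Ts_adj (linearB T).
  by rewrite !(ipE ip); lra.
apply: filterS3 uM uP (filterI optu (adjoint_state_ae_ge0 usol.1)) => x {}uM {}uP [].
rewrite -[(alpha *: u + _) x]/(alpha * u x + (q x + Ts (T u - T u0) x)) => ou oq.
rewrite -normrM -[(u - u0) x]/(u x - u0 x) ger0_norm// indicE.
case: (x \in A); rewrite ?mul0r ?mulr0// !mul1r.
apply: (@le_trans _ _ ((alpha * u x + Ts (T u - T u0) x) * (u0 x - u x))).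
  lra.
rewrite (le_trans (ler_norm _))// normrM (distrC (u0 x)) ler_wpM2r//.
rewrite (le_trans (ler_normD _ _))// lerD// normrM ger0_norm//.
by rewrite ler_wpM2l.
Qed.

End estimates.

(** * Real inequalities behind the exponents *)

Section rates.
Variable R : realType.
Implicit Types (L W K k alpha Y N D Q : R).

Lemma powR_half (x p : R) : Num.sqrt (x `^ p) = x `^ (p / 2).
Proof. by rewrite -powR12_sqrt ?powR_ge0// -powRrM. Qed.

Lemma le_of_sqr_le_powR (y c x p : R) : 0 <= y -> 0 <= c -> y ^+ 2 <= c * x `^ p ->
  y <= Num.sqrt c * x `^ (p / 2).
Proof.
move=> y0 c0 yc; rewrite -powR_half -sqrtrM// -[leLHS]ger0_norm//.
by rewrite -sqrtr_sqr ler_sqrt// mulr_ge0// powR_ge0.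
Qed.

Lemma powR_le1_le (x p r : R) : 0 < x < 1 -> r <= p -> x `^ p <= x `^ r.
Proof.
by move=> /andP[x0 x1] rp; rewrite ger_powR// x0 ltW.
Qed.

(* The level [2 alpha L] is the smallest for which the growth term absorbs
   [alpha L D]. *)
Lemma level_estimates (L W K k alpha Y N D Q : R) : 0 < L -> 0 < alpha ->
  0 <= D ->
  Y ^+ 2 + alpha * N ^+ 2 + Q <= alpha * (L * D + W * Y) ->
  2 * alpha * L * (D - K * (2 * alpha * L) `^ k) <= Q ->
  let s := K * (2 * L) `^ k in
  [/\ D <= 2 * s * alpha `^ k + W ^+ 2 / (2 * L) * alpha,
      Y ^+ 2 <= 4 * L * s * alpha `^ (k + 1) + W ^+ 2 * alpha ^+ 2
    & N ^+ 2 <= 2 * L * s * alpha `^ k + W ^+ 2 / 2 * alpha].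
Proof.
move=> L0 al0 D0 E G s.
have alk : K * (2 * alpha * L) `^ k = s * alpha `^ k.
  have L2 : 0 <= 2 * L by rewrite mulr_ge0// ltW.
  by rewrite /s (mulrAC 2) (powRM _ L2 (ltW al0)) mulrA.
have alk1 : alpha `^ (k + 1) = alpha * alpha `^ k.
  by rewrite powRD ?(gt_eqF al0) ?implybT// powRr1 1?mulrC// ltW.
rewrite alk1; move: E G; rewrite alk; move: (alpha `^ k) => x {alk alk1} E G.
have wy : alpha * (W * Y) <= 2^-1 * (Y ^+ 2 + alpha ^+ 2 * W ^+ 2).
  by have := sqr_ge0 (Y - alpha * W); lra.
(* Half of the growth term and half of [Y^2] survive the absorption; each of the three bounds
   follows by dropping the other two terms on the left. *)
have total : alpha * L * D + 2^-1 * Y ^+ 2 + alpha * N ^+ 2 <=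
    2 * alpha * L * (s * x) + 2^-1 * (alpha ^+ 2 * W ^+ 2) by lra.
have LD0 : 0 <= alpha * L * D by rewrite !mulr_ge0// ltW.
have N0 : 0 <= alpha * N ^+ 2 by rewrite mulr_ge0 ?sqr_ge0// ltW.
have Y0 := sqr_ge0 Y.
split.
- have aL : 0 < alpha * L by rewrite mulr_gt0.
  rewrite -(ler_pM2l aL).
  have -> : alpha * L * (2 * s * x + W ^+ 2 / (2 * L) * alpha) =
      2 * alpha * L * (s * x) + 2^-1 * (alpha ^+ 2 * W ^+ 2).
    by field; rewrite gt_eqF.
  lra.
- lra.
- by rewrite -(ler_pM2l al0); lra.
Qed.

(* Balancing the two error terms [K e^k] and [alpha^2 W^2 / e] gives the level
   [e ~ alpha^(2/(k+1))]. *)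
Lemma balanced_level_estimate (L W K k alpha Y D Q : R) : 0 < L -> 1 <= k ->
  0 < alpha < 1 -> 0 <= D ->
  Y ^+ 2 + Q <= alpha * (L * D + W * Y) ->
  (forall e, 0 < e -> e * (D - K * e `^ k) <= Q) ->
  D <= (2 * K * (2 * L) `^ k + W ^+ 2 / (4 * L)) * alpha `^ (2 / (1 + k^-1)).
Proof.
move=> L0 k1 al01 D0 E G; have /andP[al0 al1] := al01.
have k0 : 0 < k by rewrite (lt_le_trans _ k1).
pose t := 2 / (k + 1); set y := alpha `^ t; set p := 2 / (1 + k^-1).
have y0 : 0 < y by rewrite powR_gt0.
(* Here [k >= 1] and [alpha < 1] enter: the exponent [t] is at most 1, so the level [2 L y] is still
   large enough to absorb [alpha L D]. *)
have aly : alpha <= y.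
  rewrite /y -[leLHS]powRr1 ?(ltW al0)//; apply: powR_le1_le => //.
  by rewrite /t ler_pdivrMr ?mul1r; lra.
have tk : y `^ k = alpha `^ p.
  by rewrite -powRrM /p /t; congr (_ `^ _); field; rewrite !gt_eqF//= addr_gt0.
have tp : alpha ^+ 2 = y * alpha `^ p.
  rewrite -powR_mulrn ?ltW// -powRD; last by rewrite (gt_eqF al0) implybT.
  by rewrite /p /t; congr (_ `^ _); field; rewrite !gt_eqF//= addr_gt0.
have e0 : 0 < 2 * L * y by rewrite !mulr_gt0.
have := G _ e0; rewrite powRM ?(ltW y0) ?mulr_ge0 ?(ltW L0)// tk.
move: ((2 * L) `^ k) (alpha `^ p) tp => c x tp {G tk} G.
(* All of [Y^2] may be spent, since only [D] is estimated here. *)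
have wy : alpha * (W * Y) <= Y ^+ 2 + 4^-1 * (y * x * W ^+ 2).
  by rewrite -tp; have := sqr_ge0 (Y - alpha * W / 2); lra.
have lyD : alpha * (L * D) <= y * (L * D) by rewrite ler_wpM2r// mulr_ge0// ltW.
have Ly : 0 < L * y by rewrite mulr_gt0.
rewrite -(ler_pM2l Ly).
have -> : L * y * ((2 * K * c + W ^+ 2 / (4 * L)) * x) =
    2 * L * y * (K * (c * x)) + 4^-1 * (y * x * W ^+ 2).
  by field; rewrite gt_eqF.
lra.
Qed.

Lemma growth_null (D K k : R) : 0 <= D -> 0 <= K -> 0 < k ->
  (forall e, 0 < e -> e * (D - K * e `^ k) <= 0) -> D = 0.
Proof.
move=> D0 K0 k0 G; apply/eqP; rewrite eq_le D0 andbT leNgt; apply/negP => Dgt0.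
(* With [e^k = x] one gets [D - K e^k = x > 0], which the hypothesis excludes. *)
pose x := D / (K + 1); have K1 : 0 < K + 1 by rewrite ltr_wpDl.
have x0 : 0 < x by rewrite divr_gt0.
have := G (x `^ k^-1) (powR_gt0 _ x0).
rewrite -powRrM mulVf ?gt_eqF// powRr1 ?(ltW x0)// pmulr_rle0 ?powR_gt0//.
rewrite leNgt => /negP; apply; rewrite (_ : D - _ = x); first exact: x0.
by rewrite /x; field; rewrite gt_eqF.
Qed.

(** Enlarging [C] to [|C| + 1] supplies the positivity that [rate] demands, so that later constants
    need no sign. *)
Lemma rate_fin (I : set R) (err : R -> \bar R) (C r : R) :
  (forall alpha, I alpha -> (err alpha <= (C * alpha `^ r)%:E)%E) ->
  rate I err r%:E.
Proof.
move=> h; exists (`|C| + 1) => [|alpha Ia]; first by rewrite ltr_wpDl.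
rewrite (le_trans (h _ Ia))// lee_fin ler_wpM2r ?powR_ge0//.
by rewrite (le_trans (ler_norm _))// lerDl.
Qed.

Lemma rate_infty (I : set R) (err : R -> \bar R) :
  (forall r, 0 < r -> rate I err r%:E) -> rate I err +oo%E.
Proof. by move=> h r r0; exact: h. Qed.

End rates.

(** * Consequences of the two conditions for the unregularized problem *)

Section convergence.
Context d (X : measurableType d) (R : realType).
Variable mu : {measure set X -> \bar R}.
Hypothesis muoo : (mu setT < +oo)%E.
Variable Omega : set X.
Hypothesis Omega_full : mu (~` Omega) = 0%E.
Hypothesis mOmega : measurable Omega.
Context (H : completeNormedModType R) (ip : {dot H for idfun}).
Hypothesis ip_norm : forall h : H, ip h h = `|h| ^+ 2.
Variables (a b : X -> R) (T : {linear L2 mu -> H}) (z : H).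
Hypotheses (a_Linfty : Linfty mu a) (b_Linfty : Linfty mu b).
Variables (Ts : H -> L2 mu) (u0 q : L2 mu).
Hypothesis Ts_adj : is_adjointT ip T Ts.
Hypothesis u0_sol : is_solution a b T z 0 u0.
Hypothesis qE : forall u : L2 mu, innerU mu q u = ip (T u0 - z) (T u).
Implicit Types (A : set X) (u v : L2 mu).

Let Uad := U_ad a b : set (L2 mu).

(** The common interface of all rate proofs: it comes from the source condition, or with [w = 0]
    from full measure of [A]. *)
Definition source_bound A (w : H) (L : R) := forall v, Uad v ->
  innerU mu u0 (u0 - v) <= L * L1on mu A (v - u0) + `|w| * `|T v - T u0|.

Definition level_bound A (k C : R) := forall e : R, 0 < e ->
  (mu [set x | A x /\ (0 <= `|q x| <= e)%R] <= (C * e `^ k)%:E)%E.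

Lemma source_condition_bound A : A `<=` Omega -> measurable A ->
  source_condition Omega A a b Ts q u0 ->
  exists2 L : R, 0 < L & exists w, source_bound A w L.
Proof.
move=> AO mA [_ [w [wW [p pproj u0p]]]].
have [M M0 uM] := U_ad_ae_bounded a_Linfty b_Linfty (mu := mu).
have [W W0 {}wW] := Linfty_ae_bounded wW.
exists (M + W); first exact: addr_gt0.
exists w => v vad; apply: (source_estimate muoo ip_norm Ts_adj mA (uM _ u0_sol.1) wW).
have optp : {ae mu, forall x, 0 <= (p - Ts w) x * (v x - p x)}.
  apply: variational_inequality_ae pproj.1 _ vad => v' v'ad.
  exact: projection_variational_inequality v'ad.
have aeO : {ae mu, forall x, Omega x} by exists (~` Omega); split => //; exact: measurableC.
apply: filterS3 optp u0p aeO => x.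
rewrite -[(p - Ts w) x]/(p x - Ts w x) indicE => optp + Ox nA.
by rewrite mem_set//= !mul1r => ->.
Qed.

(** [Ts] is a bare function on representatives, constrained only by the adjoint identity, so even
    its value at 0 must be found from [|T^*0|^2 = (0, T(T^*0)) = 0], and only up to null sets. *)
Lemma adjoint0_ae : {ae mu, forall x, Ts 0 x = 0}.
Proof.
have /eqP : normU mu (Ts 0) ^+ 2 = 0 by rewrite normU_sqr Ts_adj linear0l.
rewrite sqrf_eq0 => /eqP/fine_Lnormr_eq0.
by apply: filterS => x /(_ I).
Qed.

Lemma full_measure A : measurable A -> mu (Omega `\` A) = 0%E -> mu (~` A) = 0%E.
Proof.
move=> mA A0; apply/eqP; rewrite -measure_le0.
have <- : (mu (Omega `\` A) + mu (~` Omega) = 0)%E by rewrite A0 Omega_full adde0.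
apply: (@le_trans _ _ (mu ((Omega `\` A) `|` ~` Omega))).
  apply: le_measure; rewrite ?inE.
  - exact: measurableC.
  - by apply: measurableU; [exact: measurableD|exact: measurableC].
  - by move=> x nA; have [Ox|nO] := pselect (Omega x); [left|right].
by apply: measureU2; [exact: measurableD|exact: measurableC].
Qed.

Lemma full_measure_source_bound A : measurable A -> mu (Omega `\` A) = 0%E ->
  exists2 L : R, 0 < L & source_bound A 0 L.
Proof.
move=> mA A0; have [M M0 uM] := U_ad_ae_bounded a_Linfty b_Linfty (mu := mu).
exists M => // v vad; rewrite -[M]addr0.
apply: (source_estimate muoo ip_norm Ts_adj mA (uM _ u0_sol.1)).
  by apply: filterS adjoint0_ae => x ->; rewrite normr0.
exists (~` A); split; [exact: measurableC|exact: full_measure|].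
by move=> x /not_implyP[].
Qed.

Lemma measure_condition_level A k kappa : measurable A -> 0 < k ->
  measure_condition mu Omega A q kappa -> kappa = k%:E \/ kappa = +oo%E ->
  exists2 C : R, 0 <= C & level_bound A k C.
Proof.
move=> mA k0 [_ +] [kE|kE]; rewrite kE; first by case=> _ [C C0 AC]; exists C.
move=> [e0 e00 Ae0]; have muE : mu setT = (fine (mu setT))%:E.
  by rewrite fineK// ge0_fin_numE.
have mu0 : 0 <= fine (mu setT) by rewrite fine_ge0.
have e0k : 0 < e0 `^ k by rewrite powR_gt0.
(* Up to [e0] the level sets are null; beyond it [(e / e0)^k >= 1], so this constant makes the bound
   at least the total measure. *)
exists (fine (mu setT) / e0 `^ k) => [|e eps0]; first by rewrite divr_ge0// ltW.
have mlev r : measurable [set x | A x /\ 0 <= `|q x| <= r].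
  exact: measurable_sublevel.
have [ee0|ee0] := leP e e0.
  rewrite (@le_trans _ _ 0%E)//; last first.
    by rewrite lee_fin mulr_ge0 ?powR_ge0// divr_ge0// ltW.
  rewrite -Ae0 le_measure ?inE// => x [Ax /andP[q0 qe]].
  by split=> //; rewrite q0 (le_trans qe).
apply: (@le_trans _ _ (mu setT)); first by rewrite le_measure ?inE.
rewrite {1}muE lee_fin -mulrA ler_peMr// ler_pdivlMl// mulr1.
by rewrite ge0_ler_powR ?nnegrE// ?(ltW k0) ?ltW.
Qed.

Lemma U_ad_sub_ae_bounded :
  exists2 M : R, 0 < M & forall v, Uad v -> {ae mu, forall x, `|(v - u0) x| <= M}.
Proof.
have [M M0 uM] := U_ad_ae_bounded a_Linfty b_Linfty (mu := mu).
exists (M + M) => [|v vad]; first exact: addr_gt0.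
apply: filterS2 (uM _ vad) (uM _ u0_sol.1) => x vM uM'.
by rewrite (le_trans (ler_normB _ _))// lerD.
Qed.

Lemma level_bound_growth A k C : measurable A -> 0 <= C -> level_bound A k C ->
  exists2 K : R, 0 <= K & forall v, Uad v -> forall e, 0 < e ->
    e * (L1on mu A (v - u0) - K * e `^ k) <= innerU mu q (v - u0).
Proof.
move=> mA C0 lb; have [M M0 vM] := U_ad_sub_ae_bounded.
exists (M * C) => [|v vad e e0]; first by rewrite mulr_ge0// ltW.
rewrite -mulrA; apply: (growth_condition muoo ip_norm u0_sol qE) => //.
- exact: ltW.
- exact: vM.
- exact: lb.
Qed.

(** For a second solution [(q, v - u0) = 0], so growth at every level is compatible only with a
    vanishing L^1 distance. *)
Lemma level_bound_solution_eq A k C v : measurable A -> 0 < k -> 0 <= C ->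
  level_bound A k C -> is_solution a b T z 0 v -> L1on mu A (v - u0) = 0.
Proof.
move=> mA k0 C0 lb vsol; have [K K0 G] := level_bound_growth mA C0 lb.
apply: growth_null (L1on_ge0 _ _ _) K0 k0 _ => e e0.
have [_ <-] := unregularized_solution_eq ip_norm u0_sol qE vsol.
exact: G vsol.1 _ e0.
Qed.

(** For another solution both terms of the source bound vanish, leaving [(u0, u0 - v) <= 0]; then [0
    <= |v - u0|^2 = |v|^2 - |u0|^2 + 2 (u0, u0 - v)] concludes. *)
Lemma source_bound_minimal_norm A w L : source_bound A w L ->
  (forall v, is_solution a b T z 0 v -> L1on mu A (v - u0) = 0) ->
  is_minimal_norm_solution a b T z u0.
Proof.
move=> src D0; split => // v vsol; apply: ler_normU.
have [Tv _] := unregularized_solution_eq ip_norm u0_sol qE vsol.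
have := src v vsol.1; rewrite D0// Tv subrr normr0 !mulr0 addr0 !innerUE.
have := innerU_ge0 (v - u0); rewrite !innerUE (innerUC v u0); lra.
Qed.

Lemma L1on_full_eq0 A v : measurable A -> mu (~` A) = 0%E ->
  L1on mu A (v - u0) = 0 -> {ae mu, forall x, v x = u0 x}.
Proof.
move=> mA A0 D0.
have vA : {ae mu, forall x, \1_A x * `|(v - u0) x| = 0}.
  apply: Rintegral_ge0_eq0 D0; first exact: L1on_integrable.
  by apply: aeW => x; rewrite mulr_ge0.
have aeA : {ae mu, forall x, A x} by exists (~` A); split => //; exact: measurableC.
apply: filterS2 vA aeA => x + Ax; rewrite indicE mem_set// mul1r => /eqP.
by rewrite normr_eq0 -[(v - u0) x]/(v x - u0 x) subr_eq0 => /eqP.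
Qed.

Lemma continuousU_bounded : continuousU T ->
  exists2 C : R, 0 < C & forall u, `|T u| <= C * normU mu u.
Proof.
move=> cT; have [r r0 rT] := cT 0 1 ltr01; exists r^-1 => [|u].
  by rewrite invr_gt0.
have nu := normU_ge0 u.
(* The slack [e] keeps the scaling factor [r / (normU mu u + e)] meaningful when [u] has norm 0, and
   makes the scaled function fall strictly inside the ball. *)
rewrite ler_pdivlMl//; apply/ler_addgt0Pr => e e0.
have ne : 0 < normU mu u + e by rewrite ltr_wpDl.
pose c := r / (normU mu u + e); have c0 : 0 < c by rewrite divr_gt0.
have nZ : normU mu (c *: u) = c * normU mu u.
  apply/eqP; rewrite -(@eqrXn2 _ 2)// ?normU_ge0 ?(mulr_ge0 (ltW c0) nu)//.
  by rewrite exprMn !normU_sqr !innerUE mulrA expr2.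
have := rT (c *: u); rewrite subr0 (linear0 T) subr0 nZ linearZ_LR normrZ.
rewrite (gtr0_norm c0) => h; have : c * `|T u| < 1.
  by apply: h; rewrite /c mulrAC ltr_pdivrMr// ltr_pM2l// ltrDl.
by rewrite /c mulrAC ltr_pdivrMr// mul1r => /ltW.
Qed.

(** * Convergence and rates of the regularized solutions *)

Variable ubar : R -> L2 mu.
Hypothesis ubar_sol : forall alpha, 0 < alpha -> is_solution a b T z alpha (ubar alpha).

Let D A alpha := L1on mu A (ubar alpha - u0).
Let N alpha := normU mu (ubar alpha - u0).
Let Y alpha := `|T (ubar alpha) - T u0|.

(** Sum of the two variational inequalities, each tested with the other solution; the mixed product
    is bounded through [|ubar alpha - ubar beta|^2 >= 0]. Besides the estimate of the states, it
    shows that the norm of [ubar alpha] does not increase with [alpha]. *)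
Lemma regularized_monotone alpha beta : 0 < alpha -> 0 < beta ->
  `|T (ubar alpha) - T (ubar beta)| ^+ 2 <= (beta - alpha) / 2 *
  (innerU mu (ubar alpha) (ubar alpha) - innerU mu (ubar beta) (ubar beta)).
Proof.
move=> al0 be0; have asol := ubar_sol al0; have bsol := ubar_sol be0.
have := solution_variational_inequality ip_norm asol bsol.1.
have := solution_variational_inequality ip_norm bsol asol.1.
rewrite -ip_norm !innerUE !(ipE ip) (ipC ip (T (ubar beta)) (T (ubar alpha))).
rewrite (innerUC (ubar beta) (ubar alpha)).
have : 0 <= (alpha + beta) * innerU mu (ubar alpha - ubar beta) (ubar alpha - ubar beta).
  by rewrite mulr_ge0 ?innerU_ge0// addr_ge0// ltW.
rewrite !innerUE (innerUC (ubar beta) (ubar alpha)); lra.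
Qed.

Lemma regularized_norm_le alpha : 0 < alpha ->
  innerU mu (ubar alpha) (ubar alpha) <= innerU mu u0 u0.
Proof.
move=> al0; have usol := ubar_sol al0.
have := energy_estimate ip_norm u0_sol qE usol.
have := adjoint_state_innerU_ge0 ip_norm u0_sol qE usol.1.
have := sqr_ge0 (Y alpha); rewrite /Y normU_sqr => Y0 q0 E.
have : alpha * innerU mu (ubar alpha - u0) (ubar alpha - u0) <=
       alpha * innerU mu u0 (u0 - ubar alpha) by lra.
have := innerU_ge0 (ubar alpha - u0).
rewrite ler_pM2l// !innerUE (innerUC (ubar alpha) u0); lra.
Qed.

Lemma regularized_state_le alpha : 0 < alpha ->
  Y alpha ^+ 2 <= alpha / 4 * innerU mu u0 u0.
Proof.
move=> al0; have usol := ubar_sol al0.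
have := energy_estimate ip_norm u0_sol qE usol.
have := adjoint_state_innerU_ge0 ip_norm u0_sol qE usol.1.
rewrite -/(Y alpha) normU_sqr => q0.
(* The energy estimate leaves [alpha ((u0, ubar alpha) - |ubar alpha|^2)]; completing the square
   gives the factor 1/4. *)
have : 0 <= alpha * innerU mu (ubar alpha - 2^-1 *: u0) (ubar alpha - 2^-1 *: u0).
  by rewrite mulr_ge0 ?innerU_ge0// ltW.
rewrite !innerUE (innerUC (ubar alpha) u0) in q0 *; lra.
Qed.

(* [|ubar alpha|^2] increases as [alpha] decreases to 0 and is bounded, hence
   convergent: this replaces the compactness argument for [ubar alpha]. *)
Lemma state_error_little_o (e : R) : 0 < e -> exists2 delta : R, 0 < delta &
  forall alpha, 0 < alpha < delta -> Y alpha <= e * Num.sqrt alpha.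
Proof.
move=> e0; pose n alpha := innerU mu (ubar alpha) (ubar alpha).
pose E := [set n alpha | alpha in [set alpha : R | 0 < alpha]].
have ubE : has_ubound E.
  by exists (innerU mu u0 u0) => _ [al al0 <-]; exact: regularized_norm_le.
have supE : has_sup E by split => //; exists (n 1); exists 1 => /=; rewrite ?ltr01.
have e2 : 0 < e ^+ 2 / 2 by rewrite divr_gt0// exprn_gt0.
have [_ [delta de0 <-] nde] := sup_adherent e2 supE.
exists delta => // beta /andP[be0 bede].
have n0 := innerU_ge0 u0; have e20 : 0 < e ^+ 2 by rewrite exprn_gt0.
have ne : 0 < innerU mu u0 u0 + e ^+ 2 + 1 by lra.
(* The state at [beta] is compared with the state at the smaller parameter [beta * t], where the
   crude bound of order [sqrt (beta * t)] is already below [e / 2 * sqrt beta]. The step between the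
   two costs as much, because both squared norms lie within [e^2 / 2] of the supremum. *)
pose t := e ^+ 2 / (innerU mu u0 u0 + e ^+ 2 + 1).
have t0 : 0 < t by rewrite divr_gt0.
have t1 : t < 1 by rewrite ltr_pdivrMr// mul1r; lra.
have tn : t * innerU mu u0 u0 <= e ^+ 2.
  by rewrite /t mulrAC ler_pdivrMr// ler_pM2l//; lra.
have al0 : 0 < beta * t by rewrite mulr_gt0.
have albe : beta * t < beta by rewrite gtr_pMr.
have sb : Num.sqrt beta ^+ 2 = beta by rewrite sqr_sqrtr// ltW.
have half y : 0 <= y -> y ^+ 2 <= beta * (e ^+ 2 / 4) -> y <= e / 2 * Num.sqrt beta.
  move=> y0 yb; rewrite -(ler_pXn2r (n := 2))// ?nnegrE// ?mulr_ge0 ?sqrtr_ge0 ?divr_ge0 ?(ltW e0)//.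
  by rewrite exprMn sb; lra.
have Yal : Y (beta * t) <= e / 2 * Num.sqrt beta.
  apply: half; first exact: normr_ge0.
  apply: le_trans (regularized_state_le al0) _.
  have : beta * (t * innerU mu u0 u0) <= beta * e ^+ 2 by rewrite ler_pM2l.
  lra.
have nde_be : n delta <= n beta.
  have := regularized_monotone be0 de0; have := sqr_ge0 `|T (ubar beta) - T (ubar delta)|.
  move=> s0 /(le_trans s0); rewrite pmulr_rge0 ?subr_ge0//.
  by rewrite divr_gt0// subr_gt0.
have nS : n (beta * t) <= sup E by apply: ub_le_sup => //; exists (beta * t).
have Yab : `|T (ubar (beta * t)) - T (ubar beta)| <= e / 2 * Num.sqrt beta.
  apply: half; first exact: normr_ge0.
  apply: le_trans (regularized_monotone al0 be0) _.
  rewrite -/(n (beta * t)) -/(n beta).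
  have h1 : n (beta * t) - n beta <= e ^+ 2 / 2 by lra.
  have h2 : (beta - beta * t) / 2 <= beta / 2 by lra.
  have h3 : 0 <= (beta - beta * t) / 2 by lra.
  apply: (@le_trans _ _ ((beta - beta * t) / 2 * (e ^+ 2 / 2))).
    by rewrite ler_wpM2l.
  by apply: (@le_trans _ _ (beta / 2 * (e ^+ 2 / 2))); [rewrite ler_wpM2r// ltW|lra].
rewrite /Y -(subrKA (T (ubar (beta * t)))) (le_trans (ler_normD _ _))//.
by rewrite (splitr e) mulrDl lerD// distrC.
Qed.

Lemma regularized_estimate A w L alpha : source_bound A w L -> 0 < alpha ->
  Y alpha ^+ 2 + alpha * N alpha ^+ 2 + innerU mu q (ubar alpha - u0)
  <= alpha * (L * D A alpha + `|w| * Y alpha).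
Proof.
move=> src al0; have usol := ubar_sol al0.
apply: le_trans (energy_estimate ip_norm u0_sol qE usol) _.
by rewrite ler_wpM2l ?(ltW al0)//; exact: src usol.1.
Qed.

Lemma errUE alpha : 'N[mu]_2%:E[EFin \o (ubar alpha - u0)%R]%E = (N alpha)%:E.
Proof. by rewrite -finite_norm_fine. Qed.

Lemma null_set_rates A : A `<=` Omega -> measurable A -> mu A = 0%E ->
  source_condition Omega A a b Ts q u0 ->
  [/\ is_minimal_norm_solution a b T z u0,
      exists2 C : R, 0 < C & forall alpha : R, 0 < alpha ->
        N alpha <= C * Num.sqrt alpha
    & exists2 C : R, 0 < C & forall alpha : R, 0 < alpha -> Y alpha <= C * alpha].
Proof.
move=> AO mA A0 sc; have [L L0 [w src]] := source_condition_bound AO mA sc.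
have D0 v : L1on mu A (v - u0) = 0 by exact: L1on_null.
have W1 : 0 < `|w| + 1 by rewrite ltr_wpDl.
have E alpha : 0 < alpha -> Y alpha ^+ 2 + alpha * N alpha ^+ 2 <= alpha * (`|w| * Y alpha).
  move=> al0; have := regularized_estimate src al0.
  rewrite /D D0 mulr0 add0r; apply: le_trans; rewrite lerDl.
  by apply: (adjoint_state_innerU_ge0 ip_norm u0_sol qE); exact: (ubar_sol al0).1.
split; first exact: source_bound_minimal_norm src _.
  exists (`|w| + 1) => // alpha al0; have {}E := E _ al0.
  have N0 : 0 <= N alpha by exact: normU_ge0.
  rewrite -(ler_pXn2r (n := 2))// ?nnegrE ?mulr_ge0 ?sqrtr_ge0 ?(ltW W1)//.
  rewrite exprMn sqr_sqrtr ?(ltW al0)// -(ler_pM2l al0).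
  (* Completing the square gives [alpha |w| Y - Y^2 <= alpha^2 |w|^2 / 4], hence the bound on
     [N]. *)
  have := sqr_ge0 (2 * Y alpha - alpha * `|w|).
  have : 0 <= alpha * (alpha * ((`|w| + 1) ^+ 2 - `|w| ^+ 2 / 4)).
    rewrite !mulr_ge0 ?(ltW al0)//; have := normr_ge0 w; nra.
  lra.
exists (`|w| + 1) => // alpha al0; have {}E := E _ al0.
have : 0 <= alpha * N alpha ^+ 2 by rewrite mulr_ge0 ?sqr_ge0// ltW.
have : 0 <= Y alpha by exact: normr_ge0.
rewrite le_eqVlt => /predU1P[<- _|Y0 N0]; first by rewrite mulr_ge0 ?ltW.
rewrite -(ler_pM2l Y0); have : 0 <= alpha * Y alpha by rewrite mulr_ge0 ?(ltW al0) ?(ltW Y0).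
by lra.
Qed.

Lemma full_measure_finite_rates A k L C : measurable A -> 0 < L ->
  source_bound A 0 L -> 0 < k -> 0 <= C -> level_bound A k C ->
  exists2 c : R, 0 <= c & forall alpha, 0 < alpha ->
  [/\ D A alpha <= c * alpha `^ k, N alpha <= Num.sqrt c * alpha `^ (k / 2)
    & Y alpha <= Num.sqrt c * alpha `^ ((k + 1) / 2)].
Proof.
move=> mA L0 src k0 C0 lb; have [K K0 G] := level_bound_growth mA C0 lb.
pose s := K * (2 * L) `^ k; have s0 : 0 <= s by rewrite mulr_ge0 ?powR_ge0.
have Ls : 0 <= L * s by rewrite mulr_ge0// ltW.
(* Dominates the three constants [2 s], [2 L s] and [4 L s] produced by the level estimates when
   [w = 0]. *)
exists (2 * s + 4 * L * s) => [|alpha al0]; first lra.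
have lev0 : 0 < 2 * alpha * L by rewrite !mulr_gt0.
have [] := @level_estimates _ L `|0 : H| K k alpha (Y alpha) (N alpha) (D A alpha)
  (innerU mu q (ubar alpha - u0)) L0 al0 (L1on_ge0 _ _ _)
  (regularized_estimate src al0) (G _ (ubar_sol al0).1 _ lev0).
rewrite -/s normr0 expr0n/= !mul0r !addr0 => DA YA NA.
have cge t x : 0 <= x -> 0 <= 2 * s + 4 * L * s - t -> t * x <= (2 * s + 4 * L * s) * x.
  by move=> x0; rewrite subr_ge0 => ?; rewrite ler_wpM2r.
split.
- by apply: le_trans DA _; apply: cge; [exact: powR_ge0|lra].
- apply: le_of_sqr_le_powR; [exact: normU_ge0|lra|].
  by apply: le_trans NA _; apply: cge; [exact: powR_ge0|lra].
- apply: le_of_sqr_le_powR; [exact: normr_ge0|lra|].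
  by apply: le_trans YA _; apply: cge; [exact: powR_ge0|lra].
Qed.

Lemma measure_condition_cases A kappa : measure_condition mu Omega A q kappa ->
  (exists2 k : R, 0 < k & kappa = k%:E) \/ kappa = +oo%E.
Proof.
by case: kappa => [k| |] [_ h]; [left; exists k; case: h|right|].
Qed.

Lemma Linfty_adjoint_ae : Linfty_adjoint T Ts -> exists2 c : R, 0 < c &
  forall v, {ae mu, forall x, `|Ts (T v - T u0) x| <= c * `|T v - T u0|}.
Proof.
move=> [c c0 h]; exists c => // v; apply: Lnorm_infty_ae_le.
by have [] := h (T v - T u0); first by exists (v - u0) => //; rewrite (linearB T).
Qed.

(** With [d = v - u0], Hölder applied to [|T d|^2 = (T^*T d, d)] yields [c |T d|] times the L^1
    norm, and one factor [|T d|] cancels. *)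
Lemma state_error_le_L1 A : measurable A -> mu (~` A) = 0%E ->
  Linfty_adjoint T Ts -> exists2 c : R, 0 < c &
  forall v, `|T v - T u0| <= c * L1on mu A (v - u0).
Proof.
move=> mA A0 /Linfty_adjoint_ae[c c0 h]; exists c => // v.
have : 0 <= `|T v - T u0| by [].
rewrite le_eqVlt => /predU1P[<-|y0]; first by rewrite mulr_ge0 ?L1on_ge0// ltW.
rewrite -(ler_pM2l y0) -expr2 -ip_norm -(linearB T v u0) -Ts_adj (linearB T).
rewrite mulrA (mulrC _ c) -RintegralZl//; last exact: L1on_integrable.
apply: ae_le_Rintegral.
- exact: L2_mul_integrable.
- by apply: integrable_cmul; exact: L1on_integrable.
have aeA : {ae mu, forall x, A x} by exists (~` A); split => //; exact: measurableC.
apply: filterS2 (h v) aeA => x hx Ax.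
rewrite indicE mem_set// mul1r (le_trans (ler_norm _))// normrM.
by rewrite ler_wpM2r.
Qed.

Lemma full_measure_rates A kappa : continuousU T -> measurable A ->
  mu (Omega `\` A) = 0%E -> measure_condition mu Omega A q kappa ->
  [/\ is_minimal_norm_solution a b T z u0,
      forall v, is_solution a b T z 0 v -> {ae mu, forall x, v x = u0 x},
      [/\ rate [set alpha : R | 0 < alpha] (fun alpha => (D A alpha)%:E) kappa,
          rate [set alpha : R | 0 < alpha] (fun alpha => (N alpha)%:E) (kappa / 2%:E)%E
        & rate [set alpha : R | 0 < alpha] (EFin \o Y) ((kappa + 1) / 2%:E)%E]
    & (1 < kappa)%E -> Linfty_adjoint T Ts ->
      rate [set alpha : R | 0 < alpha] (EFin \o Y) kappa].
Proof.
move=> cT mA A0 mc; have nA0 := full_measure mA A0.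
have [L L0 src] := full_measure_source_bound mA A0.
have lev k : 0 < k -> kappa = k%:E \/ kappa = +oo%E ->
    exists2 C : R, 0 <= C & level_bound A k C.
  by move=> k0 kE; exact: measure_condition_level mc kE.
have fin k (k0 : 0 < k) (kE : kappa = k%:E \/ kappa = +oo%E) :
    exists2 c : R, 0 <= c & forall alpha, 0 < alpha ->
    [/\ D A alpha <= c * alpha `^ k, N alpha <= Num.sqrt c * alpha `^ (k / 2)
      & Y alpha <= Num.sqrt c * alpha `^ ((k + 1) / 2)].
  by have [C C0 lb] := lev _ k0 kE; exact: (full_measure_finite_rates mA L0 src k0 C0 lb).
have [k [k0 kE]] : exists k, 0 < k /\ (kappa = k%:E \/ kappa = +oo%E).
  have [[k k0 ->]|->] := measure_condition_cases mc; first by exists k; auto.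
  by exists 1; auto.
have eq0 v : is_solution a b T z 0 v -> L1on mu A (v - u0) = 0.
  have [C C0 lb] := lev _ k0 kE; exact: (level_bound_solution_eq mA k0 C0 lb).
have L1rate : rate [set alpha : R | 0 < alpha] (fun alpha => (D A alpha)%:E) kappa.
  have Dk r : 0 < r -> kappa = r%:E \/ kappa = +oo%E ->
      rate [set alpha : R | 0 < alpha] (fun alpha => (D A alpha)%:E) r%:E.
    move=> r0 /(fin _ r0)[c c0 h]; apply: (@rate_fin _ _ _ c) => alpha al0.
    by rewrite lee_fin; have [] := h _ al0.
  have [[r r0 kappaE]|kappaE] := measure_condition_cases mc.
    by rewrite kappaE; apply: Dk; auto.
  by rewrite kappaE; apply: rate_infty => r r0; apply: Dk; auto.
split.
- exact: source_bound_minimal_norm src eq0.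
- by move=> v /eq0; exact: L1on_full_eq0.
- split => //.
    have [[r r0 kappaE]|kappaE] := measure_condition_cases mc.
      have [|c c0 h] := fin _ r0; first by left.
      rewrite kappaE inver pnatr_eq0/=.
      by apply: (@rate_fin _ _ _ (Num.sqrt c)) => alpha /h[_]; rewrite lee_fin.
    rewrite kappaE inver pnatr_eq0/= gt0_mulye ?lte_fin ?invr_gt0//.
    apply: rate_infty => r r0; have r20 : 0 < r * 2 by rewrite mulr_gt0.
    have [|c c0 h] := fin _ r20; first by right.
    apply: (@rate_fin _ _ _ (Num.sqrt c)) => alpha /h[_ + _].
    by rewrite lee_fin mulfK.
  have [[r r0 kappaE]|kappaE] := measure_condition_cases mc.
    have [|c c0 h] := fin _ r0; first by left.
    rewrite kappaE inver pnatr_eq0/=.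
    by apply: (@rate_fin _ _ _ (Num.sqrt c)) => alpha /h[_ _]; rewrite lee_fin.
  rewrite kappaE inver pnatr_eq0/= gt0_mulye ?lte_fin ?invr_gt0//.
  (* For small [r] the exponent [2 r - 1] is not positive, and as [alpha] is unbounded a larger
     exponent does not yield a smaller one. So the state error is bounded by the control error with
     exponent [2 r]. *)
  have [C C0 TC] := continuousU_bounded cT.
  apply: rate_infty => r r0; have r20 : 0 < r * 2 by rewrite mulr_gt0.
  have [|c c0 h] := fin _ r20; first by right.
  apply: (@rate_fin _ _ _ (C * Num.sqrt c)) => alpha /h[_ + _].
  rewrite /= lee_fin mulfK// -mulrA => NA.
  by rewrite /Y -(linearB T) (le_trans (TC _))// ler_pM2l.
- move=> _ /(state_error_le_L1 mA nA0)[c c0 YD].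
  have YDk r : rate [set alpha : R | 0 < alpha] (fun alpha => (D A alpha)%:E) r%:E ->
      rate [set alpha : R | 0 < alpha] (EFin \o Y) r%:E.
    move=> [C C0 DC]; apply: (@rate_fin _ _ _ (c * C)) => alpha al0.
    have := DC _ al0; rewrite !lee_fin => DC'.
    by rewrite /= (le_trans (YD _))// -mulrA ler_pM2l.
  move: L1rate; have [[r r0 ->]|->] := measure_condition_cases mc; first exact: YDk.
  by move=> h; apply: rate_infty => r /h; exact: YDk.
Qed.

(** With [w] present each level estimate has a second power of [alpha], with exponent 1, 1 and 2;
    for [alpha < 1] the smaller exponent wins, which produces the minima. *)
Lemma mixed_finite_rates A k w L C : measurable A -> 0 < L ->
  source_bound A w L -> 0 < k -> 0 <= C -> level_bound A k C ->
  exists2 c : R, 0 <= c & forall alpha, 0 < alpha < 1 ->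
  [/\ D A alpha <= c * alpha `^ (Num.min k 1),
      N alpha <= Num.sqrt c * alpha `^ (Num.min k 1 / 2)
    & Y alpha <= Num.sqrt c * alpha `^ (Num.min ((k + 1) / 2) 1)].
Proof.
move=> mA L0 src k0 C0 lb; have [K K0 G] := level_bound_growth mA C0 lb.
pose s := K * (2 * L) `^ k; have s0 : 0 <= s by rewrite mulr_ge0 ?powR_ge0.
have Ls : 0 <= L * s by rewrite mulr_ge0// ltW.
have w2 : 0 <= `|w| ^+ 2 by rewrite sqr_ge0.
have wL : 0 <= `|w| ^+ 2 / (2 * L) by rewrite divr_ge0// mulr_ge0// ltW.
exists (2 * s + 4 * L * s + `|w| ^+ 2 / (2 * L) + `|w| ^+ 2) => [|alpha al01].
  lra.
have /andP[al0 al1] := al01.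
have lev0 : 0 < 2 * alpha * L by rewrite !mulr_gt0.
have [] := @level_estimates _ L `|w| K k alpha (Y alpha) (N alpha) (D A alpha)
  (innerU mu q (ubar alpha - u0)) L0 al0 (L1on_ge0 _ _ _)
  (regularized_estimate src al0) (G _ (ubar_sol al0).1 _ lev0).
rewrite -/s => DA YA NA.
have comb c c1 c2 p p1 p2 : 0 <= c1 -> 0 <= c2 -> c1 + c2 <= c -> p <= p1 ->
    p <= p2 -> c1 * alpha `^ p1 + c2 * alpha `^ p2 <= c * alpha `^ p.
  move=> c10 c20 cc pp1 pp2; have x0 := powR_ge0 alpha p.
  apply: (@le_trans _ _ ((c1 + c2) * alpha `^ p)); last by rewrite ler_wpM2r.
  by rewrite mulrDl lerD// ler_wpM2l// powR_le1_le.
have al1E : alpha `^ 1 = alpha by rewrite powRr1// ltW.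
have al2E : alpha `^ 2 = alpha ^+ 2 by rewrite powR_mulrn// ltW.
split.
- rewrite (le_trans DA)// -{2}al1E; apply: comb => //; rewrite ?ge_min ?lexx ?orbT//; lra.
- apply: le_of_sqr_le_powR; [exact: normU_ge0|lra|].
  rewrite (le_trans NA)// -{2}al1E; apply: comb; rewrite ?ge_min ?lexx ?orbT//; lra.
(* The exponent is written as half of its double, to be compared with the exponents [k + 1] and 2 of
   the squared error. *)
- rewrite -[Num.min _ 1](mulfK (_ : (2 : R) != 0))//.
  apply: le_of_sqr_le_powR; [exact: normr_ge0|lra|].
  rewrite (le_trans YA)// -al2E; apply: comb; rewrite ?ge_min ?lexx ?orbT//; try lra.
    by rewrite -ler_pdivlMr// ge_min lexx.
  by rewrite -ler_pdivlMr// ge_min divff// lexx orbT.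
Qed.

(** The minimum switches at [k = 1]: up to there the level of order [alpha] already gives [alpha^k],
    beyond it that level stalls at exponent 1 and the balanced one takes over. *)
Lemma mixed_L1_rate A k w L C : measurable A -> 0 < L ->
  source_bound A w L -> 0 < k -> 0 <= C -> level_bound A k C ->
  rate [set alpha : R | 0 < alpha < 1] (fun alpha => (D A alpha)%:E)
    (Num.min k (2 / (1 + k^-1)))%:E.
Proof.
move=> mA L0 src k0 C0 lb; have [k1|k1] := leP k 1.
  have [c c0 h] := mixed_finite_rates mA L0 src k0 C0 lb.
  have -> : Num.min k (2 / (1 + k^-1)) = k.
    have ik : 1 <= k^-1 by rewrite invr_ge1// unitf_gt0.
    apply/min_idPl; rewrite ler_pdivlMr; last by lra.
    by rewrite mulrDr mulfV ?gt_eqF//; lra.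
  apply: (@rate_fin _ _ _ c) => alpha /h[+ _ _].
  by rewrite lee_fin (min_idPl k1).
have [K K0 G] := level_bound_growth mA C0 lb.
have -> : Num.min k (2 / (1 + k^-1)) = 2 / (1 + k^-1).
  have ik : 0 < k^-1 by rewrite invr_gt0.
  apply/min_idPr; rewrite ler_pdivrMr; last by lra.
  by rewrite mulrDr mulfV ?gt_eqF//; lra.
apply: rate_fin => alpha al01; have /andP[al0 _] := al01; rewrite lee_fin.
apply: (balanced_level_estimate L0 (ltW k1) al01 (L1on_ge0 _ _ _) _
  (G _ (ubar_sol al0).1)).
apply: le_trans (regularized_estimate src al0).
by rewrite lerD2r lerDl mulr_ge0 ?sqr_ge0// ltW.
Qed.

(** The level stays fixed at the width [e] of the gap, so the growth term has no loss and the error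
    is the bare [alpha^2 |w|^2 / e]. *)
Lemma mixed_L1_rate_gap A w L (e : R) : measurable A -> 0 < L ->
  source_bound A w L -> 0 < e ->
  mu [set x | A x /\ (0 <= `|q x| <= e)%R] = 0%E ->
  (exists c : R, forall alpha, 0 < alpha < 1 -> D A alpha <= c) ->
  rate [set alpha : R | 0 < alpha < 1] (fun alpha => (D A alpha)%:E) 2%:E.
Proof.
move=> mA L0 src e0 Ae0 [c Dc]; have [M M0 uM] := U_ad_sub_ae_bounded.
have w2 : 0 <= `|w| ^+ 2 by rewrite sqr_ge0.
apply: (@rate_fin _ _ _ (`|w| ^+ 2 / (2 * e) + c * (2 * L / e) ^+ 2)) => alpha al01.
have /andP[al0 al1] := al01; have D0 : 0 <= D A alpha := L1on_ge0 _ _ _.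
have c0 : 0 <= c := le_trans D0 (Dc _ al01).
have we : 0 <= `|w| ^+ 2 / (2 * e) by rewrite divr_ge0// mulr_ge0// ltW.
rewrite lee_fin powR_mulrn ?(ltW al0)//.
rewrite [leRHS](_ : _ = `|w| ^+ 2 / (2 * e) * alpha ^+ 2 +
  c * (2 * L / e * alpha) ^+ 2); last by ring.
(* Absorption works only while [2 alpha L <= e]; for larger [alpha] the uniform bound [c] is at most
   [c (2 L alpha / e)^2]. *)
have [small|large] := leP (2 * alpha * L) e; last first.
  apply: (@le_trans _ _ c); first exact: Dc.
  apply: (@le_trans _ _ (c * (2 * L / e * alpha) ^+ 2)); last first.
    by rewrite lerDr mulr_ge0// sqr_ge0.
  rewrite ler_peMr// expr_ge1// ?mulr_ge0 ?invr_ge0 ?(ltW e0) ?(ltW L0) ?(ltW al0)//.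
  by rewrite mulrAC ler_pdivlMr// mul1r; lra.
apply: (@le_trans _ _ (`|w| ^+ 2 / (2 * e) * alpha ^+ 2)); last first.
  by rewrite lerDl mulr_ge0// sqr_ge0.
have : e * (D A alpha - M * 0) <= innerU mu q (ubar alpha - u0).
  apply: (growth_condition muoo ip_norm u0_sol qE) => //.
  - exact: ltW.
  - exact: (ubar_sol al0).1.
  - exact: uM (ubar_sol al0).1.
  - by rewrite Ae0.
rewrite mulr0 subr0 => G; have := regularized_estimate src al0.
have : 0 <= alpha * N alpha ^+ 2 by rewrite mulr_ge0 ?sqr_ge0// ltW.
have := sqr_ge0 (Y alpha - alpha * `|w| / 2).
have : 2 * alpha * L * D A alpha <= e * D A alpha by rewrite ler_wpM2r.
move=> h1 h2 h3 h4; rewrite -(ler_pM2l e0).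
have -> : e * (`|w| ^+ 2 / (2 * e) * alpha ^+ 2) = `|w| ^+ 2 * alpha ^+ 2 / 2.
  by field; rewrite gt_eqF.
lra.
Qed.

(** Once the state error is of order [alpha], both perturbations of [q] in the pointwise condition
    are bounded by [P alpha], and the level [2 P alpha] absorbs them with no [w] term left. *)
Lemma mixed_bang_bang_rate A k C c : measurable A -> 0 < k -> 0 <= C ->
  level_bound A k C -> 0 <= c ->
  (forall alpha, 0 < alpha < 1 -> Y alpha <= c * alpha) -> Linfty_adjoint T Ts ->
  rate [set alpha : R | 0 < alpha < 1] (fun alpha => (D A alpha)%:E) k%:E.
Proof.
move=> mA k0 C0 lb c0 Yc /Linfty_adjoint_ae[c' c'0 h].
have [M M0 uM] := U_ad_ae_bounded a_Linfty b_Linfty (mu := mu).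
have [M' M'0 duM] := U_ad_sub_ae_bounded.
pose P := M + c' * c; have P0 : 0 < P by rewrite ltr_wpDr// mulr_ge0// ltW.
apply: (@rate_fin _ _ _ (2 * (M' * C) * (2 * P) `^ k)) => alpha al01.
have /andP[al0 al1] := al01; have uad := (ubar_sol al0).1.
have e0 : 0 < 2 * P * alpha by rewrite !mulr_gt0.
have D0 : 0 <= D A alpha := L1on_ge0 _ _ _.
have := bang_bang_estimate muoo ip_norm Ts_adj u0_sol qE mA e0 (ltW M'0) (ltW al0)
  (ubar_sol al0) (uM _ uad) (duM _ uad) (h _) (lb _ e0).
rewrite -/(D A alpha) -/(Y alpha) => E.
have {E} : 2 * P * alpha * (D A alpha - M' * (C * (2 * P * alpha) `^ k)) <=
    P * alpha * D A alpha.
  apply: le_trans E _; rewrite ler_wpM2r// /P mulrDl mulrC lerD2l -mulrA.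
  by rewrite ler_pM2l// Yc.
rewrite lee_fin powRM ?(ltW al0) ?mulr_ge0 ?(ltW P0)//.
move: ((2 * P) `^ k) (alpha `^ k) => x y E.
have Pal : 0 < P * alpha by rewrite mulr_gt0.
rewrite -(ler_pM2l Pal); lra.
Qed.

Lemma mixed_rates A kappa : A `<=` Omega -> measurable A ->
  source_condition Omega A a b Ts q u0 -> measure_condition mu Omega A q kappa ->
  [/\ is_minimal_norm_solution a b T z u0,
      [/\ rate [set alpha : R | 0 < alpha < 1] (fun alpha => (D A alpha)%:E)
            (mine kappa (2%:E / (1 + kappa^-1)))%E,
          rate [set alpha : R | 0 < alpha < 1] (fun alpha => (N alpha)%:E)
            (mine kappa 1 / 2%:E)%E
        & rate [set alpha : R | 0 < alpha < 1] (EFin \o Y)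
            (mine ((kappa + 1) / 2%:E) 1)%E]
    & (1 < kappa)%E -> Linfty_adjoint T Ts ->
      rate [set alpha : R | 0 < alpha < 1] (fun alpha => (D A alpha)%:E) kappa].
Proof.
move=> AO mA sc mc; have [L L0 [w src]] := source_condition_bound AO mA sc.
have lev k : 0 < k -> kappa = k%:E \/ kappa = +oo%E ->
    exists2 C : R, 0 <= C & level_bound A k C.
  by move=> k0 kE; exact: measure_condition_level mc kE.
have [k [k0 kE]] : exists k, 0 < k /\ (kappa = k%:E \/ kappa = +oo%E).
  have [[k k0 ->]|->] := measure_condition_cases mc; first by exists k; auto.
  by exists 1; auto.
split.
- apply: source_bound_minimal_norm src _ => v vsol.
  by have [C C0 lb] := lev _ k0 kE; exact: (level_bound_solution_eq mA k0 C0 lb).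
- have [[r r0 kappaE]|kappaE] := measure_condition_cases mc.
    have [|C C0 lb] := lev _ r0; first by left.
    have [c c0 h] := mixed_finite_rates mA L0 src r0 C0 lb.
    rewrite kappaE !inver pnatr_eq0 (gt_eqF r0)/=.
    rewrite inver gt_eqF ?addr_gt0 ?invr_gt0//= -!EFin_min /=.
    split.
    + exact: (mixed_L1_rate mA L0 src r0 C0 lb).
    + by apply: (@rate_fin _ _ _ (Num.sqrt c)) => alpha /h[_ + _]; rewrite lee_fin.
    + by apply: (@rate_fin _ _ _ (Num.sqrt c)) => alpha /h[_ _]; rewrite lee_fin.
  (* For [kappa = +oo] the exponents become 2, 1/2 and 1; the last two are already reached with
     [k = 1], and only the first needs the gap. *)
  have [|C C0 lb] := lev _ (@ltr01 R); first by right.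
  have [c c0 h] := mixed_finite_rates mA L0 src ltr01 C0 lb.
  have cY alpha : 0 < alpha < 1 -> Y alpha <= Num.sqrt c * alpha `^ 1.
    by move=> /h[_ _]; rewrite divff// minxx.
  rewrite kappaE invey adde0 inve1 mule1 inver pnatr_eq0/= gt0_mulye ?lte_fin ?invr_gt0//.
  rewrite !min_r ?leey//.
  split.
  + move: mc; rewrite kappaE => -[_ [e e0 Ae0]].
    apply: (mixed_L1_rate_gap mA L0 src e0 Ae0).
    exists c => alpha al01; have [+ _ _] := h _ al01; have /andP[al0 al1] := al01.
    by rewrite minxx powRr1 ?(ltW al0)// => /le_trans; apply; rewrite ler_piMr// ltW.
  + apply: (@rate_fin _ _ _ (Num.sqrt c)) => alpha /h[_ + _].
    by rewrite minxx lee_fin mul1r.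
  + by apply: (@rate_fin _ _ _ (Num.sqrt c)) => alpha /cY; rewrite lee_fin.
- move=> kappa1 TL; have [k' [k'1 k'E]] : exists k', 1 <= k' /\ (kappa = k'%:E \/ kappa = +oo%E).
    move: kappa1; have [[r r0 ->]|->] := measure_condition_cases mc; last by exists 1; auto.
    by rewrite lte_fin => /ltW; exists r; auto.
  have k'0 : 0 < k' by rewrite (lt_le_trans _ k'1).
  have [C C0 lb] := lev _ k'0 k'E.
  have [c c0 h] := mixed_finite_rates mA L0 src k'0 C0 lb.
  have Yc alpha : 0 < alpha < 1 -> Y alpha <= Num.sqrt c * alpha.
    move=> al01; have /andP[al0 _] := al01; have [_ _] := h _ al01.
    by rewrite min_r ?powRr1 ?(ltW al0)//; lra.
  have Dr r : 0 < r -> kappa = r%:E \/ kappa = +oo%E ->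
      rate [set alpha : R | 0 < alpha < 1] (fun alpha => (D A alpha)%:E) r%:E.
    move=> r0 /(lev _ r0)[C' C'0 lb'].
    exact: (mixed_bang_bang_rate mA r0 C'0 lb' (sqrtr_ge0 c) Yc TL).
  have [[r r0 kappaE]|kappaE] := measure_condition_cases mc.
    by rewrite kappaE; apply: Dr; auto.
  by rewrite kappaE; apply: rate_infty => r r0; apply: Dr; auto.
Qed.

End convergence.

(** * The functional [S^* h] as a continuous linear form *)

Section adjoint_functional.
Context (R : realType) (V : normedModType R).
Context (H : completeNormedModType R) (ip : {dot H for idfun}).
Variables (S : {linear V -> H}) (h : H).

Let adjointS_scalar : scalar (adjointS ip S h).
Proof. by move=> c x y; rewrite /adjointS linearP ipDl ipZl. Qed.

HB.instance Definition _ :=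
  GRing.isLinear.Build R V R *%R (adjointS ip S h) adjointS_scalar.

Definition adjointS_linear : {scalar V} := adjointS ip S h.

Lemma adjointS_continuous : (forall h : H, ip h h = `|h| ^+ 2) ->
  continuous S -> continuous (adjointS_linear : V -> R).
Proof.
move=> ip_norm cS x; apply/cvgrPdist_le => e e0.
have h1 : 0 < `|h| + 1 by rewrite ltr_wpDl.
have /cvgrPdist_le/(_ (e / (`|h| + 1))) := cS x.
rewrite divr_gt0// => /(_ isT); apply: filterS => y Sxy.
rewrite /adjointS_linear/= /adjointS -ipNl -ipDl.
apply: (@le_trans _ _ (`|S x - S y| * (`|h| + 1))).
  rewrite (@le_trans _ _ (`|S x - S y| * `|h|))// ?ler_wpM2l ?lerDl//.
  rewrite ler_norml (ip_le_norm ip_norm) andbT lerNl -ipNl.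
  by rewrite (le_trans (ip_le_norm ip_norm _ _))// normrN.
by rewrite -ler_pdivlMr.
Qed.

End adjoint_functional.

(** Supplies the finiteness of the measure on the domain. *)
Lemma bounded_lebesgue_outer_Rn (R : realType) (n : nat) (A : set 'rV[R]_n.+1) :
  bounded_set A -> (lebesgue_outer_Rn A < +oo)%E.
Proof.
move=> [M [_ AM]]; pose N := `|M| + 1.
have {AM} AN x : A x -> `|x| <= N.
  by apply: AM; rewrite (le_lt_trans (ler_norm M))// ltrDl.
(* Boxes are open on the left, so the lower corner is moved by 1 to keep points with a coordinate
   [- N]. The countable cover is this box followed by empty ones. *)
pose c : 'rV[R]_n.+1 * 'rV[R]_n.+1 := (const_mx (- N - 1), const_mx N).
pose F (k : nat) := if k == 0%N then c else (0, 0).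
have vol0 : box_volume ((0, 0) : 'rV[R]_n.+1 * 'rV[R]_n.+1) = 0%E.
  by rewrite /box_volume big_ord_recl /= subrr maxxx mul0r.
have le : (lebesgue_outer_Rn A <= \sum_(k <oo) box_volume (F k))%E.
  apply: ereal_inf_lbound; exists F => // x Ax; exists 0%N => //= i.
  rewrite !mxE.
  have : `|x 0 i| <= N.
    apply: le_trans (AN _ Ax); rewrite [leRHS]mx_normrE.
    exact: (le_bigmax _ (fun ij => `|x ij.1 ij.2|) (0, i)).
  by rewrite ler_norml => /andP[h1 h2]; apply/andP; split; lra.
apply: (le_lt_trans le); rewrite (nneseriesD1 (n := 0%N))//; last first.
  move=> k _; rewrite lee_fin; apply: prodr_ge0 => i _.
  by rewrite le_max lexx.
rewrite eseries0 ?adde0 ?ltry// => k _ /negPf k0.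
by rewrite /F k0.
Qed.

Theorem theorem11 (R : realType) (n : nat)
  (Omega : set (Rn R n)) (mOmega : measurable Omega)
  (bOmega : bounded_set (Omega : set 'rV[R]_n.+1))
  (H : completeNormedModType R) (ip : {dot H for idfun})
  (ip_norm : forall h : H, ip h h = `|h| ^+ 2) (z : H)
  (V : normedModType R)
  (T : {linear L2 (lebesgue_on mOmega) -> H})
  (B : {linear L2 (lebesgue_on mOmega) -> V}) (S : {linear V -> H})
  (cT : continuousU T) (cB : continuousU B) (cS : continuous S)
  (T_SB : forall u, T u = S (B u))
  (Ts : H -> L2 (lebesgue_on mOmega)) (Ts_adj : is_adjointT ip T Ts)
  (Bs : (V -> R) -> L2 (lebesgue_on mOmega)) (Bs_adj : is_adjointB B Bs)
  (a b : Rn R n -> R)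
  (a_Linfty : Linfty (lebesgue_on mOmega) a)
  (b_Linfty : Linfty (lebesgue_on mOmega) b)
  (le_ab : {ae lebesgue_on mOmega, forall x, a x <= b x})
  (ubar : R -> L2 (lebesgue_on mOmega))
  (ubar_sol : forall alpha : R, 0 < alpha -> is_solution a b T z alpha (ubar alpha))
  (u0 : L2 (lebesgue_on mOmega)) (u0_sol : is_solution a b T z 0 u0) :
  let mu := lebesgue_on mOmega in
  let q := Bs (adjointS ip S (T u0 - z)) in
  let du (alpha : R) : L2 mu := ubar alpha - u0 in
  let errU (alpha : R) := 'N[mu]_2%:E[EFin \o du alpha]%E in
  let errL1 (alpha : R) := 'N[mu]_1%E[EFin \o du alpha]%E in
  let errL1on A (alpha : R) := (\int[mu]_(x in A) `|du alpha x|%:E)%E in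
  let errY (alpha : R) : R^o := `|T (ubar alpha) - T u0| in
  [/\ errY =o_ (0^'+) (Num.sqrt : R -> R^o),

      forall A, A `<=` Omega -> measurable A -> mu A = 0%E ->
        source_condition Omega A a b Ts q u0 ->
        [/\ is_minimal_norm_solution a b T z u0,
            exists2 C : R, 0 < C & forall alpha : R, 0 < alpha ->
              (errU alpha <= (C * Num.sqrt alpha)%:E)%E
          & exists2 C : R, 0 < C & forall alpha : R, 0 < alpha ->
              errY alpha <= C * alpha],

      forall A kappa, A `<=` Omega -> measurable A ->
        mu (Omega `\` A) = 0%E ->
        measure_condition mu Omega A q kappa ->
        [/\ is_minimal_norm_solution a b T z u0,
            forall v, is_solution a b T z 0 v ->
              {ae mu, forall x, v x = u0 x},
            [/\ rate [set alpha : R | 0 < alpha] errL1 kappa,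
                rate [set alpha : R | 0 < alpha] errU (kappa / 2%:E)%E
              & rate [set alpha : R | 0 < alpha] (EFin \o errY)
                  ((kappa + 1) / 2%:E)%E]
          & (1 < kappa)%E -> Linfty_adjoint T Ts ->
            rate [set alpha : R | 0 < alpha] (EFin \o errY) kappa]
    & forall A kappa, A `<=` Omega -> measurable A ->
        (0 < mu A * mu (Omega `\` A))%E ->
        source_condition Omega A a b Ts q u0 ->
        measure_condition mu Omega A q kappa ->
        [/\ is_minimal_norm_solution a b T z u0,
            [/\ rate [set alpha : R | 0 < alpha < 1] (errL1on A)
                  (mine kappa (2%:E / (1 + kappa^-1)))%E,
                rate [set alpha : R | 0 < alpha < 1] errU
                  (mine kappa 1 / 2%:E)%E
              & rate [set alpha : R | 0 < alpha < 1] (EFin \o errY)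
                  (mine ((kappa + 1) / 2%:E) 1)%E]
          & (1 < kappa)%E -> Linfty_adjoint T Ts ->
            rate [set alpha : R | 0 < alpha < 1] (errL1on A) kappa]].
Proof.
move=> mu q du errU errL1 errL1on errY.
have muoo : (mu setT < +oo)%E.
  apply: le_lt_trans (bounded_lebesgue_outer_Rn bOmega).
  by rewrite -[X in (_ <= lebesgue_outer_Rn X)%E]setTI.
have Omega_full : mu (~` Omega) = 0%E.
  by rewrite -[mu _]/(lebesgue_Rn R n (~` Omega `&` Omega)) setICl measure0.
(* The only place where the factorization [T = S B] is used: [q] is reduced to the representer of
   [u |-> (T u0 - z, T u)]. *)
have qE (u : L2 mu) : innerU mu q u = ip (T u0 - z) (T u).
  rewrite /q (Bs_adj (adjointS_linear ip S (T u0 - z))).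
    by rewrite (T_SB u) ipC.
  exact: adjointS_continuous.
have errU_E alpha : errU alpha = (normU mu (du alpha))%:E by exact: errUE.
split.
- apply/eqoP => e e0.
  have [delta delta0 h] :=
    state_error_little_o ip_norm u0_sol qE ubar_sol e0.
  near=> alpha; rewrite /errY ger0_norm// ger0_norm ?sqrtr_ge0//.
  apply: h; apply/andP; split; near: alpha.
    exact: nbhs_right_gt.
  exact: nbhs_right_lt.
- move=> A AO mA A0 sc.
  have [m0 [C C0 hU] hY] := null_set_rates muoo Omega_full mOmega ip_norm
    a_Linfty b_Linfty Ts_adj u0_sol qE ubar_sol AO mA A0 sc.
  split => //; exists C => // alpha /hU; by rewrite errU_E lee_fin.
- move=> A kappa AO mA A0 mc.
  have [m0 uniq [r1 r2 r3] r4] := full_measure_rates muoo Omega_full mOmega ip_norm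
    a_Linfty b_Linfty Ts_adj u0_sol qE ubar_sol cT mA A0 mc.
  split => //; split => //.
  + rewrite (_ : errL1 = fun alpha => (L1on mu A (du alpha))%:E)//.
    apply/funext => alpha; apply: Lnorm1_L1on => //.
    exact: (full_measure Omega_full mOmega).
  + by rewrite (_ : errU = fun alpha => (normU mu (du alpha))%:E)//; exact/funext.
- move=> A kappa AO mA _ sc mc.
  have [m0 [r1 r2 r3] r4] := mixed_rates muoo Omega_full mOmega ip_norm
    a_Linfty b_Linfty Ts_adj u0_sol qE ubar_sol AO mA sc mc.
  have errL1E : errL1on A = fun alpha => (L1on mu A (du alpha))%:E.
    by apply/funext => alpha; exact: L1onE.
  split => //; last by rewrite errL1E.
  split => //; first by rewrite errL1E.
  by rewrite (_ : errU = fun alpha => (normU mu (du alpha))%:E)//; exact/funext.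
Unshelve. all: by end_near.
Qed.
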